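(* Let $n>0$ and $\ell\ge 2$ be integers, let $\mathbf r_1,\dots,\mathbf r_\ell\in\mathbb N^n$, $\mathbf r_j=(r_{j,1},\dots,r_{j,n})$, be nowhere-vanishing multi-indices, and let $J_1,\dots,J_\ell\subseteq\{1,\dots,n\}$ satisfy the running intersection property. Let $p=p_1+\dots+p_\ell$ with $p_j\in\mathbb R[x_{J_j}]_{\mathbf r_j}$ for each $j$, and set $$\overline L=\sum_{k=1}^\ell \operatorname{Lip}p_k,\qquad M=\max_{1\le k\le \ell,\ 1\le m\le n}(\overline{\deg}\,p_k)_m,\qquad \overline J=\max_{1\le k\le \ell}|J_k|.$$ Let $\varepsilon>0$. Then if $p\ge\varepsilon$ on $[-1,1]^n$, we have $$p\in \mathcal P_{\mathbf r_1,J_1}(\{1-x_i^2\}_{i\in J_1})+\dots+\mathcal P_{\mathbf r_\ell,J_\ell}(\{1-x_i^2\}_{i\in J_\ell})$$ as long as, for all $1\le j\le \ell$ and all $1\le i\le n$, $$r_{j,i}^2\ \ge\ \frac{2^{\overline J+3}(\ell+2)\,n\,\pi^2\,\|p\|_\infty}{\varepsilon}\left(\max\left(M,\ 4C_{\mathrm{Jac}}(\ell+2)\frac{\overline J\,\overline L}{\varepsilon}\right)+2\right)^{\overline J+2}.$$ For small enough $0<\varepsilon<4C_{\mathrm{Jac}}(\ell+2)\overline J\,\overline L/M$, this boils down to $$r_{j,i}\ \ge\ \sqrt{\frac{A\,\|p\|_\infty}{\varepsilon^{\overline J+3}}}=O\big(\varepsilon^{-\frac{\overline J+3}{2}}\big),$$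 with $$A=n\pi^2\,(4C_{\mathrm{Jac}}\overline J\,\overline L+2)^{\overline J+2}\,(2(\ell+2))^{\overline J+3}.$$
   Context: $\mathbb N=\{1,2,\dots\}$, $\mathbb N_0=\{0,1,2,\dots\}$. $\mathbb R[x]$ is the ring of real polynomials in $x=(x_1,\dots,x_n)$. $\|\cdot\|_\infty$ is the supremum norm on $[-1,1]^n$. For a polynomial $p$, $\overline{\deg}\,p\in\mathbb N_0^n$ is the vector whose $i$-th entry $(\overline{\deg}\,p)_i$ is the degree of $p$ in the variable $x_i$. Inequalities between multi-indices are entrywise. For $J\subseteq\{1,\dots,n\}$ and $\mathbf r\in\mathbb N_0^n$, $\mathbb R[x_J]$ is the set of polynomials in the variables $\{x_i\}_{i\in J}$ only, and $\mathbb R[x_J]_{\mathbf r}$ is the set of $p\in\mathbb R[x_J]$ with $\overline{\deg}\,p\le\mathbf r$. $\Sigma[x_J]$ is the set of finite sums of squares of elements of $\mathbb R[x_J]$. For Lipschitz $f:[-1,1]^n\to\mathbb R$, $\operatorname{Lip}f=\max\left(1,\sup_{x\ne y\in[-1,1]^n}\frac{|f(x)-f(y)|}{\|x-y\|}\right)$. Truncated preordering: for $J\subseteq\{1,\dots,n\}$, $\mathbf r\in\mathbb N_0^n$, $$\mathcal P_{\mathbf r,J}(\{1-x_i^2\}_{i\in J})=\Big\{\sum_{K\subseteq J}\sigma_K\prod_{i\in K}(1-x_i^2)\ :\ \sigma_K\in\Sigma[x_J],\ \overline{\deg}\big(\sigma_K\textstyle\prod_{i\in K}(1-x_i^2)\big)\le\mathbf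 r\Big\}$$ (the empty product is $1$). Running intersection property of $\{J_1,\dots,J_\ell\}$: for all $1\le k\le\ell-1$ there is $s\le k$ with $J_{k+1}\cap\bigcup_{j=1}^kJ_j\subseteq J_s$. Constant $C_{\mathrm{Jac}}$: for $f:[-1,1]^n\to\mathbb R$ let $\operatorname{Lip}_if$ be the best Lipschitz constant of $f$ in the variable $x_i$, uniformly in the other variables. $C_{\mathrm{Jac}}>0$ denotes a fixed absolute constant with the property that for every Lipschitz $f:[-1,1]^n\to\mathbb R$ and every $\mathbf m\in\mathbb N^n$ there is a polynomial $q$ with $\overline{\deg}\,q\le\mathbf m$, $\sup_{[-1,1]^n}|f-q|\le C_{\mathrm{Jac}}\sum_{i=1}^n\operatorname{Lip}_if/m_i$ and $\operatorname{Lip}_iq\le 2\operatorname{Lip}_if$ for all $i$. *)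

(* Defs.v *)
From mathcomp Require Export all_boot all_order all_algebra.
From mathcomp Require Export boolp classical_sets.
From mathcomp Require Export reals topology normedtype landau exp trigo.
(* The notations of [mpoly] are not imported: they clash with MathComp-Analysis. *)
From mathcomp Require Export -(notations) mpoly.

Set Implicit Arguments.
Unset Strict Implicit.
Unset Printing Implicit Defensive.

Export Order.TTheory GRing.Theory Num.Theory numFieldNormedType.Exports.

Local Open Scope ring_scope.
Local Open Scope classical_set_scope.

Notation "{ 'mpoly' R [ n ] }" := (mpoly n R)
  (at level 0, R at level 2, n at level 2) : type_scope.

Section Polynomials.
Variables (R : realType) (n : nat).
Implicit Types (p q : {mpoly R[n]}) (J : {set 'I_n}).

Definition peval p (x : 'I_n -> R) : R := meval x p.

Definition pvar (i : 'I_n) : {mpoly R[n]} :=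
  mpolyX R (mnm1 i).

(* The zero polynomial has degree 0 in every variable. *)
Definition degvar p (i : 'I_n) : nat := (\max_(m <- msupp p) m i)%N.

Definition mdeg_le p (r : 'I_n -> nat) : Prop :=
  forall i, (degvar p i <= r i)%N.

Definition in_vars J p : Prop :=
  forall m, m \in msupp p -> forall i, i \notin J -> m i = 0%N.

Definition in_vars_deg J (r : 'I_n -> nat) p : Prop :=
  in_vars J p /\ mdeg_le p r.

Definition sos J p : Prop :=
  exists s : seq {mpoly R[n]},
    (forall q, q \in s -> in_vars J q) /\ p = \sum_(q <- s) q ^+ 2.

Definition box_prod (K : {set 'I_n}) : {mpoly R[n]} :=
  \prod_(i in K) (1 - pvar i ^+ 2).

Definition preordering (r : 'I_n -> nat) J p : Prop :=
  exists sigma : {set 'I_n} -> {mpoly R[n]},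
    (forall K : {set 'I_n}, K \subset J ->
       sos J (sigma K) /\ mdeg_le (sigma K * box_prod K) r) /\
    p = \sum_(K : {set 'I_n} | K \subset J) sigma K * box_prod K.

Definition sum_preordering (l : nat) (r : 'I_l -> 'I_n -> nat)
    (J : 'I_l -> {set 'I_n}) p : Prop :=
  exists g : 'I_l -> {mpoly R[n]},
    (forall j, preordering (r j) (J j) (g j)) /\ p = \sum_(j < l) g j.

End Polynomials.

(* Indices start at 0; [k] stands for the index of the new set J_{k+1}, and the
   earlier sets are the [J j] with [j < k]. *)
Definition running_intersection (n l : nat) (J : 'I_l -> {set 'I_n}) : Prop :=
  forall k : 'I_l, (0 < k)%N ->
    exists2 s : 'I_l, (s < k)%N &
      J k :&: (\bigcup_(j < l | (j < k)%N) J j)%SET \subset J s.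

Section Lipschitz.
Variables (R : realType) (n : nat).
Implicit Types (f : ('I_n -> R) -> R) (x y : 'I_n -> R).

Definition box : set ('I_n -> R) := [set x | forall i, -1 <= x i <= 1].

Definition edist x y : R := Num.sqrt (\sum_(i < n) (x i - y i) ^+ 2).

Definition supnorm f : R := sup [set `|f x| | x in box].

Definition lipschitz_box f : Prop :=
  exists c : R, forall x y, box x -> box y -> `|f x - f y| <= c * edist x y.

(* The norm in the quotient is the Euclidean one. Meaningful for [lipschitz_box]
   functions: the real [sup] of an unbounded set is a junk value. *)
Definition Lip f : R :=
  Num.max 1 (sup [set z | exists x y,
    [/\ box x, box y, x <> y & z = `|f x - f y| / edist x y]]).

Definition Lipvar f (i : 'I_n) : R :=
  inf [set c | 0 <= c /\ forall x y, box x -> box y ->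
    (forall k, k != i -> x k = y k) -> `|f x - f y| <= c * `|x i - y i|].

End Lipschitz.

(* [C] is absolute: it does not depend on the dimension [n]. *)
Definition jackson_constant (R : realType) (C : R) : Prop :=
  0 < C /\
  forall n : nat, (0 < n)%N ->
  forall f : ('I_n -> R) -> R, lipschitz_box f ->
  forall m : 'I_n -> nat, (forall i, (0 < m i)%N) ->
  exists q : {mpoly R[n]},
    [/\ mdeg_le q m,
        supnorm (fun x => f x - peval q x)
          <= C * \sum_(i < n) Lipvar f i / (m i)%:R
      & forall i, Lipvar (peval q) i <= 2 * Lipvar f i].

(* Main.v *)
Require Import Defs.
From mathcomp Require Import derive ring lra zify.

(** Minimizing the last summand over the
    variables outside its intersection with the previous cliques yields a
    Lipschitz function [g] of the variables of an earlier clique [J_s]; subtracting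
    [g] from the last summand and adding it to the [s]-th one, one rewrites [p], by
    induction, as a sum of nonnegative functions, and Jackson approximation of the
    transferred functions [g] makes them polynomials [q_j >= eps / (4 (l + 2))]
    on the box.  As they are nonnegative with sum [p], each of them is bounded by
    the sup norm of [p].

    In one variable, let [K] be the convolution with [|sum_j c_j e^(ijt)|^2],
    [c_j = sin ((j + 1) pi / (N + 2))].  It multiplies [cos (k t)] by a [lambda_k]
    with [1 - lambda_k <= k^2 (1 - lambda_1)] and [lambda_1 = cos (pi / (N + 2))],
    so [K^-1] is close to the identity in low degree.  Writing [q = K (K^-1 q)]
    with [K] discretized at the Chebyshev nodes expresses [q] as a sum of
    weights [sos + (1 - x_i^2) sos] times positive polynomials that do not
    involve [x_i], and one concludes by induction on the number of variables. *)
Local Open Scope ring_scope.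
Local Open Scope classical_set_scope.

(** * Trigonometry *)

Section Trigonometry.
Variable R : realType.
Implicit Types (x t : R) (k : nat).

Lemma sin_le_id x : 0 <= x -> sin x <= x.
Proof.
rewrite le_eqVlt => /predU1P[<-|x0]; first by rewrite sin0.
have [c _ E] := MVT x0 (fun t _ => is_derive_sin t)
  (continuous_subspaceT (@continuous_sin R)).
move: E; rewrite sin0 !subr0 => ->.
by rewrite ler_piMl ?cos_le1// ltW.
Qed.

(** The half-angle formula reduces this to |sin (x / 2)| <= x / 2. Where the sine is negative, x / 2
    is at least [pi], hence more than 1. *)
Lemma cos_lb x : 0 <= x -> 1 - x ^+ 2 / 2 <= cos x.
Proof.
move=> x0.
have -> : cos x = 1 - 2 * sin (x / 2) ^+ 2.
  have -> : cos x = cos ((x / 2) *+ 2) by congr cos; lra.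
  rewrite cos_mulr2n cos2sin2; lra.
have [h|h] := leP 0 (sin (x / 2)).
  have h2 : sin (x / 2) <= x / 2 by apply: sin_le_id; lra.
  nra.
have h2 : -1 <= sin (x/2) by exact: sin_geN1.
have h3 : - sin (x / 2) <= x / 2.
  rewrite leNgt; apply/negP => h4.
  have h5 : x / 2 < pi by have := @pi_ge2 R; lra.
  have : 0 <= sin (x/2) by apply: sin_ge0_pi; lra.
  lra.
nra.
Qed.

Lemma sin_natmul_le k x : `|sin (k%:R * x)| <= k%:R * `|sin x|.
Proof.
elim: k => [|k IH]; first by rewrite !mul0r sin0 normr0.
rewrite -natr1 !mulrDl !mul1r sinD (le_trans (ler_normD _ _))// !normrM.
have := cos_max x; have := cos_max (k%:R * x).
have := normr_ge0 (sin (k%:R * x)); have := normr_ge0 (sin x).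
nra.
Qed.

(** By the half-angle formula this is the square of [sin_natmul_le] at x / 2. It is the source of
    the quadratic growth of [1 - jlam k]. *)
Lemma one_sub_cos_natmul k x : 1 - cos (k%:R * x) <= k%:R ^+ 2 * (1 - cos x).
Proof.
have half t : 1 - cos t = 2 * `|sin (t / 2)| ^+ 2.
  have -> : cos t = cos ((t / 2) *+ 2) by congr cos; lra.
  rewrite cos_mulr2n cos2sin2 real_normK ?num_real//; lra.
rewrite !half [leRHS]mulrCA ler_pM2l// -exprMn lerXn2r ?nnegrE//.
  by rewrite mulr_ge0.
rewrite -mulrA.
exact: sin_natmul_le.
Qed.

Lemma cosM x t : cos x * cos t = (cos (x - t) + cos (x + t)) / 2.
Proof. rewrite cosB cosD; lra. Qed.

Lemma sin_natpi k : sin (k%:R * pi) = 0 :> R.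
Proof.
elim: k => [|k IH]; first by rewrite mul0r sin0.
by rewrite -natr1 mulrDl mul1r sinDpi IH oppr0.
Qed.

(** For [a < Q], the cosines of these angles are the zeros of the Chebyshev polynomial T_Q. *)
Definition node (Q : nat) (a : nat) : R := (a.*2.+1)%:R * (pi / (Q.*2)%:R).

(** Multiplication by 2 sin b, with b = k pi / (2 Q), makes the sum telescope to sin (k pi) = 0, and
    0 < b < pi makes sin b nonzero. *)
Lemma sum_cos_node Q k : (0 < k < Q.*2)%N ->
  \sum_(a < Q) cos (k%:R * node Q a) = 0.
Proof.
move=> /andP[k0 kQ]; set b : R := k%:R * (pi / (Q.*2)%:R).
have Q0 : (0 : R) < (Q.*2)%:R by rewrite ltr0n; apply: leq_ltn_trans kQ.
have sb : 0 < sin b.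
  have := @pi_gt0 R => p0.
  apply: sin_gt0_pi; apply/andP; split.
    by rewrite /b mulr_gt0 ?ltr0n// divr_gt0.
  by rewrite /b mulrCA -[ltRHS]mulr1 ltr_pM2l// ltr_pdivrMr// mul1r ltr_nat.
have H m : \sum_(a < m) cos (k%:R * node Q a) * (2 * sin b) = sin ((m.*2)%:R * b).
  elim: m => [|m IH]; first by rewrite big_ord0 mul0r sin0.
  rewrite big_ord_recr /= IH.
  have -> : k%:R * node Q m = (m.*2)%:R * b + b.
    by rewrite /node /b -natr1 !mulrDl mul1r mulrDr mulrCA.
  have -> : (m.+1.*2)%:R * b = ((m.*2)%:R * b + b) + b.
    by rewrite doubleS -!natr1 !mulrDl mul1r.
  rewrite -{1}[(m.*2)%:R * b](addrK b); move: (_ + b) => y.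
  rewrite sinB sinD; ring.
have := H Q; rewrite -mulr_suml.
have -> : (Q.*2)%:R * b = k%:R * pi by rewrite /b; field; rewrite gt_eqF.
rewrite sin_natpi => /eqP; rewrite mulf_eq0 => /orP[/eqP//|].
by rewrite mulf_eq0 pnatr_eq0 (gt_eqF sb).
Qed.

Definition nodesum Q (j k : nat) : R :=
  \sum_(a < Q) cos (j%:R * node Q a) * cos (k%:R * node Q a).

(** Discrete orthogonality of the cosines: the product formula leaves the frequencies j - k and j +
    k, and each of them sums to 0 unless it is 0 itself. *)
Lemma nodesumE Q j k : (j + k < Q.*2)%N ->
  nodesum Q j k = (j == k)%:R * Q%:R * (if k == 0%N then 1 else 2^-1).
Proof.
move=> jk; rewrite /nodesum.
wlog kj : j k jk / (k <= j)%N => [W|].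
  have [/W-> //|jk'] := leqP k j.
  rewrite (eq_bigr (fun a : 'I_Q => cos (k%:R * node Q a) * cos (j%:R * node Q a))).
    rewrite W ?(ltnW jk')// 1?addnC// [(k == j)]eq_sym; case: eqP => [->//|_].
    by rewrite !mul0r.
  by move=> a _; rewrite mulrC.
have -> : \sum_(a < Q) cos (j%:R * node Q a) * cos (k%:R * node Q a)
   = (\sum_(a < Q) cos ((j - k)%:R * node Q a)
     + \sum_(a < Q) cos ((j + k)%:R * node Q a)) / 2.
  rewrite -big_split /= mulr_suml; apply: eq_bigr => a _.
  by rewrite cosM natrB// natrD -mulrBl -mulrDl.
have [E|ne] := eqVneq j k.
  rewrite -E subnn.
  under eq_bigr do rewrite mul0r cos0.
  rewrite sumr_const card_ord mul1r.
  have [->|j0] := eqVneq j 0%N.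
    under eq_bigr do rewrite addn0 mul0r cos0.
    rewrite sumr_const card_ord; lra.
  by rewrite sum_cos_node ?addr0//; lia.
rewrite !sum_cos_node ?addr0 ?mul0r//; lia.
Qed.

End Trigonometry.

(** * The Jackson kernel *)

Section JacksonKernel.
Variables (R : realType) (N Q : nat).
Hypothesis Q_gt0 : (0 < Q)%N.

Definition jangle : R := pi / N.+2%:R.
(** These form the Perron eigenvector of the path with [N.+1] vertices, see
    [sum_jcoef_neighbours]. *)
Definition jcoef (j : nat) : R := sin (j.+1%:R * jangle).
Definition jmass : R := \sum_(j < N.+1) jcoef j ^+ 2.
Definition absd (i j : nat) : nat := (i - j + (j - i))%N.
(* With [F t = |sum_j c_j e^(ijt)|^2], this is [(F (t - s) + F (t + s)) / 2]. *)
Definition jfun (t s : R) : R :=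
  \sum_(i < N.+1) \sum_(j < N.+1)
    jcoef i * jcoef j * (cos ((absd i j)%:R * t) * cos ((absd i j)%:R * s)).
(* The eigenvalue of the kernel at [cos (k t)], as a mean of [F t * cos (k t)] *)
Definition jlam (k : nat) : R :=
  (Q%:R * jmass)^-1 * \sum_(a < Q) jfun 0 (node R Q a) * cos (k%:R * node R Q a).


Lemma cos_absd i j (t : R) :
  cos ((absd i j)%:R * t) = cos (i%:R * t) * cos (j%:R * t) + sin (i%:R * t) * sin (j%:R * t).
Proof.
rewrite -cosB -mulrBl /absd; have [ij|/ltnW ij] := leqP i j.
  by rewrite (eqP ij) add0n natrB// -cosN -mulNr opprB.
by rewrite (eqP ij) addn0 natrB.
Qed.

Lemma jangle_gt0 : 0 < jangle.
Proof. by rewrite divr_gt0 ?pi_gt0. Qed.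

Lemma jmass_gt0 : 0 < jmass.
Proof.
rewrite /jmass big_ord_recl ltr_pwDl ?sumr_ge0// => [|i _]; last exact: sqr_ge0.
rewrite exprn_gt0// /jcoef mul1r sin_gt0_pi// jangle_gt0/=.
rewrite ltr_pdivrMr// ltr_pMr ?pi_gt0//.
by rewrite (ltr_nat _ 1).
Qed.

(** At t = 0 the double sum is the squared modulus of a trigonometric polynomial, split into its
    real and imaginary parts. *)
Lemma jfun0_ge0 s : 0 <= jfun 0 s.
Proof.
have -> : jfun 0 s = (\sum_(i < N.+1) jcoef i * cos (i%:R * s)) ^+ 2
                   + (\sum_(i < N.+1) jcoef i * sin (i%:R * s)) ^+ 2.
  rewrite !expr2 !mulr_suml -big_split/=; apply: eq_bigr => i _.
  rewrite !mulr_sumr -big_split/=; apply: eq_bigr => j _.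
  rewrite mulr0 cos0 mul1r cos_absd; ring.
by rewrite addr_ge0 ?sqr_ge0.
Qed.

Lemma sum_jfun t k :
  \sum_(a < Q) jfun t (node R Q a) * cos (k%:R * node R Q a) =
  \sum_(i < N.+1) \sum_(j < N.+1)
    jcoef i * jcoef j * (cos ((absd i j)%:R * t) * nodesum R Q (absd i j) k).
Proof.
under eq_bigr do rewrite mulr_suml.
rewrite exchange_big/=; apply: eq_bigr => i _.
under eq_bigr do rewrite mulr_suml.
rewrite exchange_big/=; apply: eq_bigr => j _.
rewrite /nodesum !mulr_sumr; apply: eq_bigr => a _; ring.
Qed.

Lemma absd_lt (i j : 'I_N.+1) : (absd i j <= N)%N.
Proof. by have := ltn_ord i; have := ltn_ord j; rewrite /absd; lia. Qed.

(** Orthogonality keeps only the pairs with |i - j| = k. Each of them carries the factor cos (k t),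
    and what remains is the value at t = 0. *)
Lemma jfun_eigen t k : (N + k < Q.*2)%N ->
  (Q%:R * jmass)^-1 * \sum_(a < Q) jfun t (node R Q a) * cos (k%:R * node R Q a)
  = jlam k * cos (k%:R * t).
Proof.
move=> Nk; rewrite /jlam -mulrA; congr (_ * _).
rewrite !sum_jfun mulr_suml; apply: eq_bigr => i _.
rewrite mulr_suml; apply: eq_bigr => j _.
rewrite nodesumE; last by have := absd_lt i j; lia.
case: eqP => [->|_]; last by rewrite !mul0r !mulr0 mul0r.
by rewrite !(mulr0, cos0, mul1r) !mulrA; ring.
Qed.

Lemma sum_jcoef_diag (i : 'I_N.+1) :
  \sum_(j < N.+1) jcoef j * (absd i j == 0%N)%:R = jcoef i.
Proof.
rewrite (bigD1 i)//= big1 ?addr0.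
  by rewrite /absd subnn eqxx mulr1.
move=> j ji; rewrite (_ : (absd i j == 0%N) = false) ?mulr0//.
apply: contra_neqF ji => /eqP; rewrite /absd => h; apply/val_inj => /=; lia.
Qed.

(** The addition formulas give c_(i-1) + c_(i+1) = 2 cos [jangle] c_i. The neighbours missing at the
    two ends fit in, since sin 0 = sin pi = 0. *)
Lemma sum_jcoef_neighbours (i : 'I_N.+1) :
  \sum_(j < N.+1) jcoef j * (absd i j == 1%N)%:R = 2 * cos jangle * jcoef i.
Proof.
have Z : sin (N.+2%:R * jangle) = 0.
  by rewrite /jangle mulrCA divff ?mulr1 ?sinpi// pnatr_eq0.
have E (j : nat) : (absd i j == 1%N)%:R = (j == i.+1)%:R + (i == j.+1 :> nat)%:R :> R.
  rewrite -natrD; congr _%:R; rewrite /absd.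
  by case: (ltngtP i j) => ij; do 3 (case: eqP => ?); lia.
under eq_bigr do rewrite E mulrDr.
rewrite big_split/=.
have -> : \sum_(j < N.+1) jcoef j * (j == i.+1 :> nat)%:R = jcoef i.+1.
  have [iN|iN] := ltnP i.+1 N.+1.
    rewrite (bigD1 (Ordinal iN))//= eqxx mulr1 big1 ?addr0// => j ji.
    rewrite (_ : (j == i.+1 :> nat) = false) ?mulr0//.
    by apply: contra_neqF ji => /eqP ji; apply/val_inj.
  have iE : i = N :> nat by have := ltn_ord i; lia.
  rewrite iE /jcoef Z big1// => j _.
  by rewrite ltn_eqF ?mulr0.
have -> : \sum_(j < N.+1) jcoef j * (i == j.+1 :> nat)%:R = sin (i%:R * jangle).
  case: i {E} => [[|i] iN] /=.
    by rewrite mul0r sin0 big1// => j _; rewrite mulr0.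
  have iN' : (i < N.+1)%N by lia.
  rewrite (bigD1 (Ordinal iN'))//= eqxx mulr1 big1 ?addr0// => j ji.
  rewrite (_ : (i.+1 == j.+1) = false) ?mulr0//.
  by apply: contra_neqF ji; rewrite eqSS => /eqP ji; apply/val_inj.
rewrite /jcoef.
have -> : i.+2%:R * jangle = i.+1%:R * jangle + jangle by rewrite -natr1 mulrDl mul1r.
have -> : i%:R * jangle = i.+1%:R * jangle - jangle.
  by rewrite -natr1 mulrDl mul1r addrK.
rewrite sinD sinB; ring.
Qed.

Let Q0 : (0 : R) < Q%:R. Proof. by rewrite ltr0n. Qed.

Lemma jlam0 : (N < Q.*2)%N -> jlam 0 = 1.
Proof.
move=> NQ; rewrite /jlam sum_jfun.
rewrite (_ : \sum_(_ < _) _ = Q%:R * jmass).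
  by rewrite mulVf// gt_eqF// mulr_gt0// jmass_gt0.
rewrite /jmass mulr_sumr; apply: eq_bigr => i _.
rewrite expr2 -{3}(@sum_jcoef_diag i) !mulr_sumr; apply: eq_bigr => j _.
rewrite nodesumE; last by have := absd_lt i j; lia.
rewrite !mulr0 cos0 eqxx; ring.
Qed.

Lemma jlam1 : (N.+1 < Q.*2)%N -> jlam 1 = cos jangle.
Proof.
move=> NQ; rewrite /jlam sum_jfun.
rewrite (_ : \sum_(_ < _) _ = Q%:R * jmass * cos jangle).
  by rewrite mulKf// gt_eqF// mulr_gt0// jmass_gt0.
rewrite /jmass mulr_sumr mulr_suml; apply: eq_bigr => i _.
transitivity (Q%:R * jcoef i * (\sum_(j < N.+1) jcoef j * (absd i j == 1%N)%:R) / 2).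
  rewrite mulr_sumr mulr_suml; apply: eq_bigr => j _.
  rewrite nodesumE; last by have := absd_lt i j; lia.
  by rewrite mulr0 cos0 /=; field.
by rewrite sum_jcoef_neighbours; field.
Qed.

(** The numbers 1 - lambda_k are averages of 1 - cos (k s) against the nonnegative weights [jfun 0],
    so [one_sub_cos_natmul] bounds them by k^2 (1 - lambda_1). The exact value of lambda_1 and
    [cos_lb] conclude. *)
Lemma jlam_lb k : (N.+1 < Q.*2)%N -> 1 - k%:R ^+ 2 * jangle ^+ 2 / 2 <= jlam k.
Proof.
move=> NQ.
have QS : 0 < (Q%:R * jmass)^-1 by rewrite invr_gt0 mulr_gt0// jmass_gt0.
have l1 : 1 - jangle ^+ 2 / 2 <= jlam 1 by rewrite jlam1// cos_lb// ltW ?jangle_gt0.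
suff H : 1 - jlam k <= k%:R ^+ 2 * (1 - jlam 1).
  have := sqr_ge0 (k%:R : R); nra.
have one : 1 = (Q%:R * jmass)^-1 * \sum_(a < Q) jfun 0 (node R Q a).
  rewrite -[LHS](jlam0) 1?ltnW// /jlam; congr (_ * _); apply: eq_bigr => a _.
  by rewrite mul0r cos0 mulr1.
have D m : 1 - jlam m = (Q%:R * jmass)^-1 *
    \sum_(a < Q) jfun 0 (node R Q a) * (1 - cos (m%:R * node R Q a)).
  rewrite {1}one /jlam -mulrBr -sumrB; congr (_ * _).
  by apply: eq_bigr => a _; rewrite mulrBr mulr1.
rewrite !D mulrCA ler_pM2l// mulr_sumr ler_sum// => a _.
rewrite [leRHS]mulrCA ler_wpM2l ?jfun0_ge0// mul1r.
exact: one_sub_cos_natmul.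
Qed.

End JacksonKernel.

(** * Chebyshev polynomials of both kinds *)

Section Chebyshev.
Variable R : realType.

(* The components are the Chebyshev polynomials [T_k] and [U_(k-1)]. *)
Fixpoint cheb (k : nat) : {poly R} * {poly R} :=
  if k is k'.+1 then
    ('X * (cheb k').1 - (1 - 'X ^+ 2) * (cheb k').2, 'X * (cheb k').2 + (cheb k').1)
  else (1, 0).

Lemma cheb_cos k t : (cheb k).1.[cos t] = cos (k%:R * t)
  /\ sin t * (cheb k).2.[cos t] = sin (k%:R * t).
Proof.
elim: k => [|k [IH1 IH2]] /=.
  by rewrite mul0r cos0 sin0 !hornerE.
have -> : k.+1%:R * t = k%:R * t + t by rewrite -natr1 mulrDl mul1r.
rewrite cosD sinD !hornerE IH1; split.
  by rewrite -sin2cos2 -IH2; ring.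
rewrite -IH2; ring.
Qed.

Lemma size_polyM_le (p q : {poly R}) a b :
  (size p <= a)%N -> (size q <= b)%N -> (size (p * q)%R <= (a + b).-1)%N.
Proof.
move=> pa qb; apply: leq_trans (size_polyMleq _ _) _.
by rewrite -!subn1 leq_sub2r// leq_add.
Qed.

Lemma size_one_subX2 : (size (1 - 'X ^+ 2 : {poly R})%R <= 3)%N.
Proof.
rewrite (leq_trans (size_polyD _ _))// size_polyN size_polyXn size_polyC.
by rewrite geq_max andbT (leq_trans (leq_b1 _)).
Qed.

Lemma size_cheb k : (size (cheb k).1 <= k.+1)%N /\ (size (cheb k).2 <= k)%N.
Proof.
have sX : (size ('X : {poly R}) <= 2)%N by rewrite size_polyX.
elim: k => [|k [IH1 IH2]] /=.
  by rewrite size_polyC size_poly0 oner_eq0.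
split.
  rewrite (leq_trans (size_polyD _ _))// size_polyN geq_max; apply/andP; split.
    exact: size_polyM_le sX IH1.
  exact: size_polyM_le size_one_subX2 IH2.
rewrite (leq_trans (size_polyD _ _))// geq_max IH1 andbT.
exact: size_polyM_le sX IH2.
Qed.

(** Frequencies are recentred at [h]: for j <= 2 h the index |j - h| is at most h, so that squares
    of combinations have degree at most 2 h. The sign in [chebU] reflects the oddness of the
    sine. *)
Definition chebT j h := (cheb (absd j h)).1.
Definition chebU j h := (-1) ^+ (j < h)%N *: (cheb (absd j h)).2.

Lemma chebT_cos j h t : (chebT j h).[cos t] = cos (j%:R * t - h%:R * t).
Proof. by rewrite (cheb_cos _ _).1 cos_absd cosB. Qed.

Lemma chebU_cos j h t : sin t * (chebU j h).[cos t] = sin (j%:R * t - h%:R * t).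
Proof.
rewrite hornerZ mulrCA (cheb_cos _ _).2 /absd -mulrBl; have [jh|hj] := ltnP j h.
  rewrite (eqP (ltnW jh)) add0n natrB 1?ltnW// expr1 mulN1r -sinN -mulNr.
  by rewrite opprB.
by rewrite (eqP hj) addn0 natrB// expr0 mul1r.
Qed.

Lemma poly_eq_cos (p q : {poly R}) : (forall t, p.[cos t] = q.[cos t]) -> p = q.
Proof.
move=> H; apply/eqP; rewrite -subr_eq0; apply/eqP.
(* The points 1 / (i + 1) lie in [-1, 1], hence are cosines; they are distinct and as many as the
   size of p - q, which exceeds its degree. *)
pose s := [seq (i.+1%:R)^-1 : R | i <- iota 0 (size (p - q))].
apply: (@roots_geq_poly_eq0 _ _ s).
- apply/allP => x /mapP[i _ ->]; rewrite rootE !hornerE.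
  have i01 : -1 <= (i.+1%:R^-1 : R) <= 1.
    by rewrite invf_le1// ler1n andbT (le_trans (@lerN10 R))// invr_ge0.
  by rewrite -(@acosK R (i.+1%:R)^-1) ?in_itv//= H subrr.
- rewrite map_inj_uniq ?iota_uniq// => i j /invr_inj/eqP.
  by rewrite eqr_nat eqSS => /eqP.
- by rewrite size_map size_iota.
Qed.

End Chebyshev.

Lemma absd_half h (j : 'I_h.*2.+1) : (absd j h <= h)%N.
Proof. by have := ltn_ord j; rewrite /absd; lia. Qed.

(** * Quadrature by the kernel and its inverse *)

Section KernelQuadrature.
Variables (R : realType) (h d : nat).
Let N := h.*2.
(** With this many nodes, N + k and j + k stay below 2 Q for all j, k <= d, so every orthogonality
    relation used below is exact. *)
Let Q := (N + d).+1.
Let al : R := jangle R N.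
Let c : R := (Q%:R * jmass R N)^-1.
Let lam (k : nat) : R := jlam R N Q k.
Let th (a : nat) : R := node R Q a.

(* The matrix, at the nodes, of [K^-1 - 1] on polynomials of degree at most [d] *)
Definition kinv (a b : nat) : R :=
  Q%:R^-1 * \sum_(k < d) 2 * ((lam k.+1)^-1 - 1) *
     (cos (k.+1%:R * th a) * cos (k.+1%:R * th b)).

Hypothesis dal : (d%:R * al) ^+ 2 <= 1.

Let Q0 : (0 : R) < Q%:R. Proof. by rewrite ltr0n. Qed.

Let c0 : 0 < c. Proof. by rewrite /c invr_gt0 mulr_gt0 ?jmass_gt0. Qed.

Let al0 : 0 < al. Proof. exact: jangle_gt0. Qed.

(** With X = (d al)^2 <= 1, [jlam_lb] gives lam k >= 1 - X / 2 >= 1 / 2, and (1 + X) (1 - X / 2) >=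
    1 bounds the inverse by 1 + X. *)
Lemma lam_lb k : (k <= d)%N ->
  1 / 2 <= lam k /\ (lam k)^-1 - 1 <= (d%:R * al) ^+ 2.
Proof.
move=> kd.
have l1 : 1 - (d%:R * al) ^+ 2 / 2 <= lam k.
  apply: le_trans (_ : 1 - (k%:R * al) ^+ 2 / 2 <= _).
    have : (k%:R * al) ^+ 2 <= (d%:R * al) ^+ 2.
      by rewrite ler_sqr ?ler_pM2r ?ler_nat// nnegrE mulr_ge0// ltW.
    lra.
  rewrite exprMn; apply: jlam_lb => //; rewrite /Q /N; lia.
move: l1 dal (sqr_ge0 (d%:R * al)); move: (_ ^+ 2) (lam k) => X u l1 X1 X0.
have l2 : 1 / 2 <= u by lra.
split => //; have up : 0 < u by lra.
rewrite lerBlDr -[leLHS]mul1r ler_pdivrMr//; nra.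
Qed.

Lemma kinv_sum a : \sum_(b < Q) `|kinv a b| <= 2 * d%:R * (d%:R * al) ^+ 2.
Proof.
have H b : `|kinv a b| <= Q%:R^-1 * (2 * d%:R * (d%:R * al) ^+ 2).
  rewrite /kinv normrM ger0_norm ?invr_ge0// ler_pM2l ?invr_gt0//.
  apply: (le_trans (ler_norm_sum _ _ _)).
  have -> : 2 * d%:R * (d%:R * al) ^+ 2 = \sum_(k < d) 2 * (d%:R * al) ^+ 2.
    by rewrite sumr_const card_ord -[RHS]mulr_natr; ring.
  apply: ler_sum => k _.
  have [l1 l2] := lam_lb _ (ltn_ord k).
  (* An average of cosines against nonnegative weights of total [lam 0 = 1] is at most 1; this gives
     the sign needed to drop the absolute value. *)
  have l3 : 0 <= (lam k.+1)^-1 - 1.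
    rewrite subr_ge0 invf_ge1; last by lra.
    have NQ : (N + 0 < Q.*2)%N by rewrite /Q /N; lia.
    have le1 : \sum_(a < Q) jfun R N 0 (th a) * cos (k.+1%:R * th a) <=
               \sum_(a < Q) jfun R N 0 (th a) * cos (0%:R * th a).
      apply: ler_sum => i _; rewrite ler_wpM2l ?jfun0_ge0//.
      by rewrite mul0r cos0 cos_le1.
    have <- : jlam R N Q 0 = 1 by apply: jlam0 => //; rewrite /Q /N; lia.
    by rewrite /lam /jlam ler_pM2l.
  rewrite normrM (normrM 2) (ger0_norm (ler0n _ 2)) (ger0_norm l3).
  rewrite -mulrA ler_pM2l//.
  rewrite -[leRHS]mulr1 ler_pM// normrM mulr_ile1 ?cos_max//.
apply: (@le_trans _ _ (\sum_(b < Q) Q%:R^-1 * (2 * d%:R * (d%:R * al) ^+ 2))).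
  by apply: ler_sum => b _; exact: H.
by rewrite sumr_const card_ord -[leLHS]mulr_natl mulVKf// gt_eqF.
Qed.

(** This is g = K (K^-1 g), where K^-1 = 1 + [kinv] acts on the node values and K is sampled at the
    nodes. *)
Definition reproduced (g : R -> R) := forall t, g t =
  \sum_(a < Q) c * jfun R N t (th a) * (g (th a) + \sum_(b < Q) kinv a b * g (th b)).

Lemma reproduced_cos k : (k <= d)%N -> reproduced (fun t => cos (k%:R * t)).
Proof.
move=> kd t.
have lamn0 : lam k != 0 by rewrite gt_eqF//; have := (lam_lb _ kd).1; lra.
transitivity ((lam k)^-1 * (lam k * cos (k%:R * t))); first by rewrite mulKf.
rewrite /lam -jfun_eigen// -/(lam k) -/c; last by rewrite /Q /N; lia.
rewrite mulrA [LHS]mulr_sumr; apply: eq_bigr => a _.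
(* By orthogonality the node values of cos (k t) are an eigenvector of [kinv]; the factor 1 /
   [lam k] then cancels the eigenvalue of K. *)
suff -> : \sum_(b < Q) kinv a b * cos (k%:R * th b) = ((lam k)^-1 - 1) * cos (k%:R * th a).
  rewrite -/(th a); ring.
transitivity (Q%:R^-1 * \sum_(j < d) 2 * ((lam j.+1)^-1 - 1) *
     (cos (j.+1%:R * th a) * nodesum R Q j.+1 k)).
  under eq_bigr do rewrite /kinv -mulrA mulr_suml.
  rewrite -mulr_sumr exchange_big/=; congr (_ * _); apply: eq_bigr => j _.
  rewrite /nodesum !mulr_sumr; apply: eq_bigr => b _; rewrite -/(th b); ring.
have ns (j : 'I_d) : nodesum R Q j.+1 k =
   (j.+1 == k)%:R * Q%:R * (if k == 0%N then 1 else 2^-1).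
  by apply: nodesumE; have := ltn_ord j; rewrite /Q /N; lia.
under eq_bigr do rewrite ns.
(* For k = 0 no term of [kinv] matches, in agreement with [lam 0 = 1]. *)
case: k kd {lamn0 ns} => [|k] kd.
  rewrite big1 => [|j _]; last by rewrite !mul0r !mulr0.
  by rewrite mulr0 /lam jlam0 ?invr1 ?subrr ?mul0r//; rewrite /Q /N; lia.
rewrite (bigD1 (Ordinal kd))//= big1 => [|j jk].
  have : 0 < lam k.+1 by have := (lam_lb _ kd).1; lra.
  rewrite eqxx /=; move: (lam k.+1) (cos _) => u x /lt0r_neq0 u0.
  by move: (Q%:R) (lt0r_neq0 Q0) => q q0; field; rewrite u0 q0.
rewrite eqSS (_ : (j == k :> nat) = false) ?mul0r ?mulr0//.
by apply: contra_neqF jk => /eqP jk; apply/val_inj.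
Qed.

Lemma reproduced_cosX a b : (a + b <= d)%N ->
  reproduced (fun t => cos t ^+ a * cos (b%:R * t)).
Proof.
elim: a b => [|a IH] b abd.
  move=> t; rewrite (reproduced_cos _ abd t) mul1r.
  apply: eq_bigr => i _; congr (_ * _); rewrite mul1r; congr (_ + _).
  by apply: eq_bigr => j _; rewrite mul1r.
(* [b'] is |b - 1|: the product cos t cos (b t) averages the frequencies b + 1 and |b - 1|. *)
pose b' := if b is b1.+1 then b1 else 1%N.
have E (t : R) : cos t ^+ a.+1 * cos (b%:R * t) =
   (cos t ^+ a * cos (b.+1%:R * t) + cos t ^+ a * cos (b'%:R * t)) / 2.
  rewrite exprSr -mulrA (cosM R t) -mulrDr mulrA; congr (_ / _); congr (_ * _).
  rewrite addrC; congr (_ + _); first by congr cos; rewrite -natr1; ring.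
  rewrite /b'; case: (b) => [|b1]; first by congr cos; ring.
  by rewrite -cosN; congr cos; rewrite -natr1; ring.
move=> t; rewrite E (IH b.+1) 1?(IH b') /b'; [|by case: (b) abd => [|?]; lia|lia].
rewrite -big_split/= mulr_suml; apply: eq_bigr => i _.
rewrite -mulrDr -mulrA; congr (_ * _).
under [in RHS]eq_bigr do rewrite E mulrA mulrDr.
rewrite E -mulr_suml big_split/=; ring.
Qed.

(** The phase e^(-iht) does not change the modulus of sum_j c_j e^(ijt). Averaging over t - s and t
    + s separates the parts even and odd in t: the first two squares are those of polynomials in cos
    t, the last two those of sin t times such polynomials. *)
Lemma jfun_squares t s :
  jfun R N t s =
  (\sum_(j < N.+1) jcoef R N j * (cos (j%:R * s - h%:R * s) * cos (j%:R * t - h%:R * t))) ^+ 2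
  + (\sum_(j < N.+1) jcoef R N j * (sin (j%:R * s - h%:R * s) * cos (j%:R * t - h%:R * t))) ^+ 2
  + ((\sum_(j < N.+1) jcoef R N j * (sin (j%:R * s - h%:R * s) * sin (j%:R * t - h%:R * t))) ^+ 2
  + (\sum_(j < N.+1) jcoef R N j * (cos (j%:R * s - h%:R * s) * sin (j%:R * t - h%:R * t))) ^+ 2).
Proof.
have H i j x : cos ((absd i j)%:R * x) =
    cos (i%:R * x - h%:R * x) * cos (j%:R * x - h%:R * x)
  + sin (i%:R * x - h%:R * x) * sin (j%:R * x - h%:R * x).
  by rewrite -cosB cos_absd -cosB; congr cos; ring.
rewrite /jfun !expr2 !mulr_suml -!big_split/=; apply: eq_bigr => i _.
rewrite !mulr_sumr -!big_split/=; apply: eq_bigr => j _.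
rewrite !H; ring.
Qed.

Definition kpoly (f : R -> R) (P : nat -> nat -> {poly R}) (a : nat) : {poly R} :=
  Num.sqrt c *: \sum_(j < N.+1) (jcoef R N j * f (j%:R * th a - h%:R * th a)) *: P j h.

Lemma size_kpoly f (P : nat -> nat -> {poly R}) a m : (forall j : 'I_N.+1, (size (P j h) <= m)%N) ->
  (size (kpoly f P a) <= m)%N.
Proof.
move=> Pm; apply: leq_trans (size_scale_leq _ _) _.
apply: leq_trans (size_sum _ _ _) _; apply/bigmax_leqP => j _.
exact: leq_trans (size_scale_leq _ _) (Pm j).
Qed.

Definition kweight a : {poly R} :=
  kpoly cos (@chebT R) a ^+ 2 + kpoly sin (@chebT R) a ^+ 2
  + (1 - 'X ^+ 2) * (kpoly sin (@chebU R) a ^+ 2 + kpoly cos (@chebU R) a ^+ 2).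

(** The identity sin^2 = 1 - cos^2 turns the odd squares of [jfun_squares] into multiples of 1 -
    X^2; the square roots of [c] recombine. *)
Lemma kweight_cos a t : (kweight a).[cos t] = c * jfun R N t (th a).
Proof.
have HT f : (kpoly f (@chebT R) a).[cos t] = Num.sqrt c *
    \sum_(j < N.+1) jcoef R N j * (f (j%:R * th a - h%:R * th a) * cos (j%:R * t - h%:R * t)).
  rewrite hornerZ horner_sum; congr (_ * _); apply: eq_bigr => j _.
  by rewrite hornerZ chebT_cos mulrA.
have HU f : sin t * (kpoly f (@chebU R) a).[cos t] = Num.sqrt c *
    \sum_(j < N.+1) jcoef R N j * (f (j%:R * th a - h%:R * th a) * sin (j%:R * t - h%:R * t)).
  rewrite hornerZ horner_sum mulrCA; congr (_ * _).
  rewrite mulr_sumr; apply: eq_bigr => j _.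
  by rewrite hornerZ -chebU_cos; ring.
transitivity ((kpoly cos (@chebT R) a).[cos t] ^+ 2 + (kpoly sin (@chebT R) a).[cos t] ^+ 2
    + ((sin t * (kpoly sin (@chebU R) a).[cos t]) ^+ 2
       + (sin t * (kpoly cos (@chebU R) a).[cos t]) ^+ 2)).
  rewrite /kweight !(hornerD, hornerM, hornerN, horner_exp, hornerC, hornerX).
  rewrite -sin2cos2; ring.
rewrite !HT !HU jfun_squares; move: (\sum_(_ < _) _) => x1; move: (\sum_(_ < _) _) => x2.
move: (\sum_(_ < _) _) => x3; move: (\sum_(_ < _) _) => x4.
by rewrite !exprMn (sqr_sqrtr (ltW c0)) -!mulrDr.
Qed.

Lemma kernel_quadrature k : (k <= d)%N ->
  'X^k = \sum_(a < Q) (cos (th a) ^+ k + \sum_(b < Q) kinv a b * cos (th b) ^+ k)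
           *: kweight a.
Proof.
move=> kd; apply: poly_eq_cos => t.
have kd0 : (k + 0 <= d)%N by rewrite addn0.
have := reproduced_cosX _ _ kd0 t; rewrite mul0r cos0 mulr1 hornerXn => ->.
rewrite horner_sum; apply: eq_bigr => a _.
rewrite hornerZ kweight_cos mulrC mul0r cos0 mulr1; congr ((_ + _) * _).
by apply: eq_bigr => b _; rewrite mul0r cos0 mulr1.
Qed.

End KernelQuadrature.

Lemma jackson_kernel (R : realType) (d r : nat) :
  (0 < r)%N -> (d%:R * pi) ^+ 2 <= r%:R ^+ 2 :> R ->
  exists (Q : nat) (y : 'I_Q -> R) (E : 'I_Q -> 'I_Q -> R) (A B C D : 'I_Q -> {poly R})
    (h : nat),
  [/\ (h.*2 <= r)%N, forall a, -1 <= y a <= 1,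
      forall a, [/\ size (A a) <= h.+1, size (B a) <= h.+1, size (C a) <= h & size (D a) <= h]%N,
      forall a, \sum_b `|E a b| <= 2 * d%:R ^+ 3 * pi ^+ 2 / r%:R ^+ 2
    & forall k, (k <= d)%N ->
      'X^k = \sum_a (y a ^+ k + \sum_b E a b * y b ^+ k) *:
         (A a ^+ 2 + B a ^+ 2 + (1 - 'X ^+ 2) * (C a ^+ 2 + D a ^+ 2))].
Proof.
(* Rounding down keeps the degree 2 h of the weights below r, while 2 h + 2 >= r keeps [jangle]
   below pi / r. *)
move=> r0 dr; pose h := (r./2)%N.
have r0' : (0 : R) < r%:R by rewrite ltr0n.
have al_le : jangle R h.*2 <= pi / r%:R.
  rewrite /jangle ler_pM2l ?pi_gt0// lef_pV2 ?posrE// ler_nat /h; lia.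
have al2 : (d%:R * jangle R h.*2) ^+ 2 <= (d%:R * (pi / r%:R)) ^+ 2.
  have pr : 0 <= pi / r%:R :> R by rewrite divr_ge0// pi_ge0.
  have a0 : 0 <= jangle R h.*2 := ltW (jangle_gt0 _ _).
  have m1 := mulr_ge0 (ler0n R d) a0; have m2 := mulr_ge0 (ler0n R d) pr.
  by apply: lerXn2r; rewrite ?nnegrE//; apply: ler_wpM2l.
have dal : (d%:R * jangle R h.*2) ^+ 2 <= 1.
  apply: le_trans al2 _.
  by rewrite mulrA expr_div_n ler_pdivrMr ?mul1r// exprn_gt0.
pose Q := (h.*2 + d).+1.
exists Q, (fun a => cos (node R Q a)), (fun a b => @kinv R h d a b),
  (fun a => @kpoly R h d cos (@chebT R) a), (fun a => @kpoly R h d sin (@chebT R) a),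
  (fun a => @kpoly R h d sin (@chebU R) a), (fun a => @kpoly R h d cos (@chebU R) a), h.
split.
- rewrite /h; lia.
- by move=> a; rewrite cos_geN1 cos_le1.
- have T (j : 'I_h.*2.+1) : (size (chebT R j h) <= h.+1)%N.
    by rewrite (leq_trans (size_cheb _ _).1)// ltnS absd_half.
  have U (j : 'I_h.*2.+1) : (size (chebU R j h) <= h)%N.
    by rewrite (leq_trans (size_scale_leq _ _))// (leq_trans (size_cheb _ _).2)// absd_half.
  by move=> a; split; apply: size_kpoly.
- move=> a; apply: le_trans (kinv_sum _ _ _ dal a) _.
  apply: le_trans (_ : 2 * d%:R * (d%:R * (pi / r%:R)) ^+ 2 <= _).
    by rewrite ler_wpM2l// mulr_ge0.
  by rewrite le_eqVlt; apply/orP; left; apply/eqP; field; rewrite gt_eqF.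
- move=> k kd; exact: (kernel_quadrature _ _ _ dal _ kd).
Qed.

Set Implicit Arguments.
Unset Strict Implicit.
Unset Printing Implicit Defensive.

(** * Monomial supports and preorderings *)

Section MonomialSupport.
Variables (R : realType) (n : nat).
Implicit Types (P : multinom n -> Prop) (p q : {mpoly R[n]}) (J K : {set 'I_n}).

(** A common form of [in_vars] and, through [mdeg_leE], of [mdeg_le], so that closure properties are
    proved once for both. *)
Definition supp_in P p := forall m, m \in msupp p -> P m.

Lemma supp_in0 P : supp_in P (0 : {mpoly R[n]}).
Proof. by move=> m; rewrite msupp0. Qed.

Lemma supp_inD P p q : supp_in P p -> supp_in P q -> supp_in P (p + q).
Proof. by move=> Pp Pq m /msuppD_le; rewrite mem_cat => /orP[/Pp|/Pq]. Qed.

Lemma supp_in_sum P (I : Type) (s : seq I) (Q : pred I) (F : I -> {mpoly R[n]}) :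
  (forall i, Q i -> supp_in P (F i)) -> supp_in P (\sum_(i <- s | Q i) F i).
Proof.
move=> PF; elim/big_rec: _ => [|i p Qi Pp]; first exact: supp_in0.
exact: supp_inD (PF i Qi) Pp.
Qed.

Lemma supp_inZ P c p : supp_in P p -> supp_in P (c *: p).
Proof. by move=> Pp m /msuppZ_le/Pp. Qed.

Lemma supp_inX P m : P m -> supp_in P (mpolyX R m).
Proof. by move=> Pm m'; rewrite msuppX inE => /eqP ->. Qed.

Lemma supp_inN P p : supp_in P p -> supp_in P (- p).
Proof. by rewrite -scaleN1r; exact: supp_inZ. Qed.

Lemma supp_inC P (c : R) : P mnm0 -> supp_in P (mpolyC n c).
Proof. by move=> P0 m; rewrite msuppC; case: ifP => //= _; rewrite inE => /eqP ->. Qed.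

Lemma supp_inM P P1 P2 p q : (forall m1 m2, P1 m1 -> P2 m2 -> P (mnm_add m1 m2)) ->
  supp_in P1 p -> supp_in P2 q -> supp_in P (p * q).
Proof. by move=> H h1 h2 m /msuppM_le/allpairsP[[m1 m2] /= [/h1 ? /h2 ? ->]]; apply: H. Qed.

Lemma supp_inW P1 P2 p : (forall m, P1 m -> P2 m) -> supp_in P1 p -> supp_in P2 p.
Proof. by move=> H h m /h/H. Qed.

Definition vars_in J (m : multinom n) := forall i, i \notin J -> m i = 0%N.
Definition degs_le (r : 'I_n -> nat) (m : multinom n) := forall i, (m i <= r i)%N.

Lemma mdeg_leE r p : mdeg_le p r <-> supp_in (degs_le r) p.
Proof.
split=> [H m mp i|H i]; last by apply/bigmax_leqP_seq => m mp _; exact: H.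
by have /bigmax_leqP_seq := H i; apply.
Qed.

Lemma vars_inD J m1 m2 : vars_in J m1 -> vars_in J m2 -> vars_in J (mnm_add m1 m2).
Proof. by move=> h1 h2 i iJ; rewrite mnmDE h1// h2. Qed.

Lemma in_varsM J p q : in_vars J p -> in_vars J q -> in_vars J (p * q).
Proof. exact: supp_inM (@vars_inD J). Qed.

Lemma in_vars1 J : in_vars J (1 : {mpoly R[n]}).
Proof. by apply: (@supp_inC (vars_in J) 1) => i _; rewrite mnm0E. Qed.

Lemma in_varsW J K p : J \subset K -> in_vars J p -> in_vars K p.
Proof.
move=> JK; apply: supp_inW => m Jm i iK; apply: Jm.
by apply: contra iK; exact: (fintype.subsetP JK).
Qed.

Lemma mdeg_leM r1 r2 r p q : (forall i, (r1 i + r2 i <= r i)%N) ->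
  mdeg_le p r1 -> mdeg_le q r2 -> mdeg_le (p * q) r.
Proof.
move=> rr /mdeg_leE h1 /mdeg_leE h2; apply/mdeg_leE; apply: supp_inM h1 h2.
by move=> m1 m2 h1 h2 i; rewrite mnmDE (leq_trans _ (rr i))// leq_add.
Qed.

Lemma mdeg_le_vars J r p : in_vars J p -> mdeg_le p r ->
  mdeg_le p (fun i => if i \in J then r i else 0%N).
Proof.
move=> Jp /mdeg_leE rp; apply/mdeg_leE => m mp i.
by case: ifP => [_|/negbT iJ]; [exact: rp|rewrite (Jp m)].
Qed.

Lemma in_vars_box K : in_vars K (box_prod R K).
Proof.
rewrite /box_prod; elim/big_ind: _ => [|p q|i iK]; [exact: in_vars1|exact: in_varsM|].
apply: (@supp_inD (vars_in K)); first exact: in_vars1.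
apply: (@supp_inN (vars_in K)).
have Ki : in_vars K (pvar R i).
  apply: (@supp_inX (vars_in K)) => j jK; rewrite mnm1E; case: eqP => // ij.
  by move: jK; rewrite -ij iK.
by rewrite expr2; exact: in_varsM.
Qed.

Lemma sos_in_vars J p : sos J p -> in_vars J p.
Proof.
move=> [s [Js ->]]; rewrite big_seq; apply: (@supp_in_sum (vars_in J)) => q qs.
by rewrite expr2; apply: in_varsM; exact: Js.
Qed.

Lemma sos0 J : sos J (0 : {mpoly R[n]}).
Proof. by exists [::]; rewrite big_nil. Qed.

Lemma sosD J p q : sos J p -> sos J q -> sos J (p + q).
Proof.
move=> [s [Js ->]] [t [Jt ->]]; exists (s ++ t); rewrite big_cat; split => // u.
by rewrite mem_cat => /orP[/Js|/Jt].
Qed.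

Lemma sosM_sqr J p u : sos J p -> in_vars J u -> sos J (u ^+ 2 * p).
Proof.
move=> [s [Js ->]] Ju; exists [seq u * q | q <- s]; split.
  by move=> v /mapP[q qs ->]; apply: in_varsM => //; exact: Js.
by rewrite big_map mulr_sumr; apply: eq_bigr => q _; rewrite exprMn.
Qed.

Lemma sosW J K p : J \subset K -> sos J p -> sos K p.
Proof. by move=> JK [s [Js ->]]; exists s; split => // q /Js; exact: in_varsW. Qed.

Lemma preordering0 r J : preordering r J (0 : {mpoly R[n]}).
Proof.
exists (fun=> 0); split=> [K KJ|]; last by rewrite big1// => K _; rewrite mul0r.
split; first exact: sos0.
by rewrite mul0r => i; rewrite /degvar msupp0 big_nil.
Qed.

Lemma preorderingD r J p q :
  preordering r J p -> preordering r J q -> preordering r J (p + q).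
Proof.
move=> [s [hs ->]] [t [ht ->]]; exists (fun K => s K + t K); split=> [K KJ|].
  have [s1 s2] := hs K KJ; have [t1 t2] := ht K KJ.
  split; first exact: sosD.
  by rewrite mulrDl; apply/mdeg_leE; apply: supp_inD; apply/mdeg_leE.
by rewrite -big_split /=; apply: eq_bigr => K _; rewrite mulrDl.
Qed.

Lemma preordering_const r (c : R) : 0 <= c -> preordering r (@finset.set0 'I_n) (mpolyC n c).
Proof.
move=> c0; exists (fun=> mpolyC n c); split=> [K|].
  rewrite finset.subset0 => /eqP ->; split.
    exists [:: mpolyC n (Num.sqrt c)]; split.
      move=> q; rewrite inE => /eqP ->; apply: (@supp_inC (vars_in (@finset.set0 'I_n))) => i _.
      by rewrite mnm0E.
    by rewrite big_seq1 expr2 -mpolyCM -expr2 sqr_sqrtr.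
  rewrite /box_prod big_set0 mulr1; apply/mdeg_leE.
  by apply: (@supp_inC (degs_le r)) => i; rewrite mnm0E.
rewrite (bigD1 (@finset.set0 'I_n))//= big1 ?addr0 => [|K].
  by rewrite /box_prod big_set0 mulr1.
by rewrite finset.subset0 => /andP[/eqP ->]; rewrite eqxx.
Qed.

End MonomialSupport.

(** * Univariate polynomials as multipliers of preorderings *)

Section OneVariable.
Variables (R : realType) (n : nat) (i : 'I_n).
Implicit Types (w : {poly R}) (p q : {mpoly R[n]}).

Definition poly_at w : {mpoly R[n]} := horner_alg (pvar R i) w.

Lemma poly_atX k : poly_at ('X ^+ k) = pvar R i ^+ k.
Proof. by rewrite /poly_at rmorphXn/= horner_algX. Qed.

Lemma poly_atZ c w : poly_at (c *: w) = c *: poly_at w.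
Proof. by rewrite /poly_at linearZ /= mulr_algl. Qed.

Lemma poly_at_supp w k : (size w <= k.+1)%N ->
  supp_in (fun m => (forall j, j != i -> m j = 0%N) /\ (m i <= k)%N) (poly_at w).
Proof.
move=> wk; rewrite -(coefK w) poly_def /poly_at linear_sum; apply: supp_in_sum => a _.
rewrite /= -/(poly_at _) poly_atZ poly_atX.
apply: (@supp_inZ R n).
have -> : pvar R i ^+ a = mpolyX R (mnm_muln (mnm1 i) a).
  by rewrite /pvar mpolyXn.
apply: supp_inX; rewrite mulmnE mnm1E eqxx mul1n; split.
  by move=> j ji; rewrite mulmnE mnm1E eq_sym (negbTE ji).
by rewrite -ltnS (leq_trans _ wk).
Qed.

Lemma poly_at_vars (J : {set 'I_n}) w : i \in J -> in_vars J (poly_at w).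
Proof.
move=> iJ; apply: supp_inW (poly_at_supp (leqnSn _)) => m [m0 _] j jJ.
by apply: m0; apply: contraNneq jJ => ->.
Qed.

Lemma poly_at_deg w k : (size w <= k.+1)%N ->
  mdeg_le (poly_at w) (fun j => if j == i then k else 0%N).
Proof.
move=> wk; apply/mdeg_leE; apply: supp_inW (poly_at_supp wk) => m [m0 mk] j.
by case: eqP => [->//|/eqP/m0 ->].
Qed.

(** The two factors share no variable, so their degrees do not add up. *)
Lemma mulr_poly_at_deg (J : {set 'I_n}) (r : 'I_n -> nat) w p k :
  (k <= r i)%N -> i \notin J -> (size w <= k.+1)%N -> in_vars J p -> mdeg_le p r ->
  mdeg_le (poly_at w * p) r.
Proof.
move=> kr iJ wk Jp rp; apply: mdeg_leM (poly_at_deg wk) (mdeg_le_vars Jp rp).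
by move=> j; case: eqP => [->|_]; rewrite ?(negbTE iJ) ?addn0//; case: ifP.
Qed.

(** The part A^2 + B^2 multiplies the coefficient of each K without i, and the part with 1 - X^2
    moves the term of K to that of K with i added. *)
Lemma preordering_mul_poly_at (J : {set 'I_n}) (r : 'I_n -> nat) (A B C D : {poly R}) h g :
  i \in J -> (h.*2 <= r i)%N ->
  (size A <= h.+1)%N -> (size B <= h.+1)%N -> (size C <= h)%N -> (size D <= h)%N ->
  preordering r (J :\ i) g ->
  preordering r J (poly_at (A ^+ 2 + B ^+ 2 + (1 - 'X ^+ 2) * (C ^+ 2 + D ^+ 2)) * g).
Proof.
move=> iJ hr sA sB sC sD [s [hs ->]].
have iJi : i \notin J :\ i by rewrite !inE eqxx.
have sq (p : {poly R}) k : (size p <= k.+1)%N -> (size (p ^+ 2)%R <= k.*2.+1)%N.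
  by move=> pk; rewrite expr2; apply: leq_trans (size_polyM_le _ _ _ _ _ pk pk) _; lia.
have sAB : (size (A ^+ 2 + B ^+ 2)%R <= h.*2.+1)%N.
  by rewrite (leq_trans (size_polyD _ _))// geq_max !sq.
have sCD : (size ((1 - 'X ^+ 2) * (C ^+ 2 + D ^+ 2))%R <= h.*2.+1)%N.
  (* For h = 0 the size bounds force C = D = 0; otherwise the squares have degree at most 2 (h - 1),
     which leaves room for 1 - X^2. *)
  case: h sC sD {hr sA sB sAB} => [|h] sC sD.
    move: sC sD; rewrite !leqn0 !size_poly_eq0 => /eqP -> /eqP ->.
    by rewrite expr0n addr0 mulr0 size_poly0.
  have s2 : (size (C ^+ 2 + D ^+ 2)%R <= h.*2.+1)%N.
    by rewrite (leq_trans (size_polyD _ _))// geq_max !sq.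
  by apply: leq_trans (size_polyM_le _ _ _ _ _ (size_one_subX2 R) s2) _; lia.
pose U : {mpoly R[n]} := poly_at A ^+ 2 + poly_at B ^+ 2.
pose V : {mpoly R[n]} := poly_at C ^+ 2 + poly_at D ^+ 2.
have UE : U = poly_at (A ^+ 2 + B ^+ 2) by rewrite /poly_at rmorphD !rmorphXn.
have VE : (1 - pvar R i ^+ 2) * V = poly_at ((1 - 'X ^+ 2) * (C ^+ 2 + D ^+ 2)).
  by rewrite /poly_at rmorphM rmorphB rmorph1 rmorphD !rmorphXn/= horner_algX.
exists (fun K : {set 'I_n} => if i \in K then V * s (K :\ i) else U * s K); split=> [K KJ|].
  have [iK|iK] := boolP (i \in K).
    have KJi : K :\ i \subset J :\ i by exact: finset.setSD.
    have [s1 s2] := hs _ KJi; split.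
      have sJ := sosW (finset.subsetDl J [set i]%SET) s1.
      by rewrite /V mulrDl; apply: sosD; apply: sosM_sqr => //; exact: poly_at_vars.
    have -> : V * s (K :\ i) * box_prod R K =
        (1 - pvar R i ^+ 2) * V * (s (K :\ i) * box_prod R (K :\ i)).
      by rewrite {1}/box_prod (big_setD1 i iK)/= -/(box_prod _ _); ring.
    rewrite VE; apply: (@mulr_poly_at_deg (J :\ i) _ _ _ _ hr) => //.
    apply: in_varsM; [exact: sos_in_vars|apply: (in_varsW KJi); exact: in_vars_box].
  have KJi : K \subset J :\ i by rewrite finset.subsetD1 KJ.
  have [s1 s2] := hs _ KJi; split.
    have sJ := sosW (finset.subsetDl J [set i]%SET) s1.
    by rewrite /U mulrDl; apply: sosD; apply: sosM_sqr => //; exact: poly_at_vars.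
  rewrite -mulrA UE; apply: (@mulr_poly_at_deg (J :\ i) _ _ _ _ hr) => //.
  apply: in_varsM; [exact: sos_in_vars|apply: (in_varsW KJi); exact: in_vars_box].
rewrite [RHS](bigID (fun K : {set 'I_n} => i \in K))/=.
have -> : poly_at (A ^+ 2 + B ^+ 2 + (1 - 'X ^+ 2) * (C ^+ 2 + D ^+ 2)) =
    (1 - pvar R i ^+ 2) * V + U.
  by rewrite UE VE /poly_at -rmorphD/= addrC.
rewrite mulrDl; congr (_ + _).
  rewrite mulr_sumr [RHS](reindex_onto (fun K : {set 'I_n} => i |: K) (fun K => K :\ i))/=.
    apply: eq_big => [K|K KJ].
      rewrite finset.subsetD1 finset.setU11 andbT finset.subUset finset.sub1set iJ/=; congr (_ && _).
      apply/idP/eqP => [iK|<-]; first by rewrite finset.setU1K.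
      by rewrite !inE eqxx.
    have iK : i \notin K by move: KJ; rewrite finset.subsetD1 => /andP[].
    rewrite finset.setU11 finset.setU1K// [X in _ = _ * X]/box_prod (big_setU1 _ iK)/= -/(box_prod _ _).
    ring.
  by move=> K /andP[_ iK]; exact: finset.setD1K.
rewrite mulr_sumr; apply: eq_big => [K|K KJ]; first by rewrite finset.subsetD1.
by move: KJ; rewrite finset.subsetD1 => /andP[_ /negbTE ->]; rewrite mulrA.
Qed.

End OneVariable.

(** * Positive polynomials in the variables of one clique *)

Section Restriction.
Variables (R : realType) (n : nat).
Implicit Types (p q : {mpoly R[n]}) (J : {set 'I_n}) (x c : 'I_n -> R).

Definition mix J x c : 'I_n -> R := fun i => if i \in J then x i else c i.

Definition mnm_restr J (m : multinom n) : multinom n :=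
  Multinom [tuple (if i \in J then m i else 0%N) | i < n].

Lemma mnm_restrE J m i : mnm_restr J m i = if i \in J then m i else 0%N.
Proof. by rewrite /mnm_restr mnmE. Qed.

(** Substitution of [c] for the variables outside [J], spelled out on monomials so that the new
    support can be read off. *)
Definition specialize J c p : {mpoly R[n]} :=
  \sum_(m <- msupp p) (mcoeff m p * \prod_(i | i \notin J) c i ^+ m i)
     *: mpolyX R (mnm_restr J m).

Lemma specialize_supp (P P' : multinom n -> Prop) J c p :
  (forall m, P m -> P' (mnm_restr J m)) -> supp_in P p -> supp_in P' (specialize J c p).
Proof.
move=> H Pp; rewrite /specialize big_seq; apply: supp_in_sum => m mp.
by apply: supp_inZ; apply: supp_inX; apply: H; exact: Pp.
Qed.

Lemma specialize_vars J K r c p : in_vars_deg K r p ->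
  in_vars_deg (K :&: J) r (specialize J c p).
Proof.
move=> [Kp /mdeg_leE rp]; split.
  apply: (@specialize_supp (vars_in K) (vars_in (K :&: J))) => // m Km i.
  by rewrite inE negb_and mnm_restrE => /orP[/Km ->|/negbTE ->] //; case: ifP.
apply/mdeg_leE; apply: specialize_supp rp => m rm i.
by rewrite mnm_restrE; case: ifP.
Qed.

Lemma pevalD p q x : peval (p + q) x = peval p x + peval q x.
Proof. exact: mevalD. Qed.

Lemma pevalN p x : peval (- p) x = - peval p x.
Proof. exact: mevalN. Qed.

Lemma pevalZ a p x : peval (a *: p) x = a * peval p x.
Proof. exact: mevalZ. Qed.

Lemma pevalC a x : peval (mpolyC n a) x = a.
Proof. exact: mevalC. Qed.

Lemma peval_sum (I : Type) (s : seq I) (P : pred I) (F : I -> {mpoly R[n]}) x :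
  peval (\sum_(i <- s | P i) F i) x = \sum_(i <- s | P i) peval (F i) x.
Proof. exact: raddf_sum. Qed.

Lemma peval_specialize J c p x : peval (specialize J c p) x = peval p (mix J x c).
Proof.
rewrite /peval /specialize raddf_sum/= [RHS]mevalE; apply: eq_bigr => m _.
rewrite mevalZ mevalX -mulrA; congr (_ * _).
rewrite [RHS](bigID (fun i => i \in J))/= mulrC; congr (_ * _).
  rewrite (bigID (fun i => i \in J))/= [X in _ * X]big1 ?mulr1.
    by apply: eq_bigr => i iJ; rewrite mnm_restrE /mix iJ.
  by move=> i /negbTE iJ; rewrite mnm_restrE iJ.
by apply: eq_bigr => i /negbTE iJ; rewrite /mix iJ.
Qed.

Lemma specialize1 i y p :
  specialize [set~ i] (fun=> y) p = \sum_(m <- msupp p) (mcoeff m p * y ^+ m i)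
    *: mpolyX R (mnm_restr [set~ i] m).
Proof.
apply: eq_bigr => m _; rewrite (big_pred1 i)// => j.
by rewrite /= !inE negbK.
Qed.

Lemma mpolyX_split i (m : multinom n) :
  mpolyX R m = pvar R i ^+ m i * mpolyX R (mnm_restr [set~ i] m).
Proof.
rewrite /pvar mpolyXn -mpolyXD; congr (mpolyX R _); apply/mnmP => j.
rewrite mnmDE mulmnE mnm1E mnm_restrE !inE eq_sym.
by case: eqP => [->|_]; rewrite ?mul1n ?addn0.
Qed.

End Restriction.

Section BoxBounds.
Variables (R : realType) (n : nat).
Implicit Types (p q : {mpoly R[n]}) (J : {set 'I_n}) (x y : 'I_n -> R).

Lemma box_mix J x y : box x -> box y -> box (mix J x y).
Proof. by move=> bx b_y i; rewrite /mix; case: ifP. Qed.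

Lemma box0 : box (fun=> 0 : R) (n := n).
Proof. by move=> i; rewrite lerN10 ler01. Qed.

Lemma box_cst (y : R) : -1 <= y <= 1 -> box (fun=> y) (n := n).
Proof. by move=> yb i. Qed.

Lemma in_vars_set0 p : in_vars (@finset.set0 'I_n) p -> p = mpolyC n (mcoeff mnm0 p).
Proof.
move=> h; apply/mpolyP => m; rewrite mcoeffC.
have [->|m0] := eqVneq m mnm0; first by rewrite mulr1.
rewrite mulr0; apply/eqP; rewrite mcoeff_eq0; apply: contraNN m0 => mp.
by apply/eqP/mnmP => i; rewrite mnm0E; apply: (h _ mp); rewrite inE.
Qed.

End BoxBounds.

(** * Certificates by elimination of one variable at a time *)

Section KernelPreordering.
Variables (R : realType) (n : nat).
Implicit Types (p q : {mpoly R[n]}) (J : {set 'I_n}) (x y : 'I_n -> R).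

(** The quadrature formula replaces the power of x_i in each monomial by weights in x_i times
    combinations of node values, and these combinations assemble into slices of q free of x_i. *)
Lemma specialize_quadrature (i : 'I_n) (d Q : nat) (y : 'I_Q -> R) (E : 'I_Q -> 'I_Q -> R)
    (w : 'I_Q -> {poly R}) q :
  (forall k, (k <= d)%N -> 'X^k = \sum_a (y a ^+ k + \sum_b E a b * y b ^+ k) *: w a) ->
  (degvar q i <= d)%N ->
  q = \sum_a poly_at i (w a) * (specialize [set~ i] (fun=> y a) q
        + \sum_b E a b *: specialize [set~ i] (fun=> y b) q).
Proof.
move=> H qd.
have sp a : specialize [set~ i] (fun=> y a) q + \sum_b E a b *: specialize [set~ i] (fun=> y b) q
  = \sum_(m <- msupp q) (mcoeff m q * (y a ^+ m i + \sum_b E a b * y b ^+ m i))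
       *: mpolyX R (mnm_restr [set~ i] m).
  under eq_bigr do rewrite specialize1 scaler_sumr.
  rewrite exchange_big specialize1 -big_split/=; apply: eq_bigr => m _.
  under eq_bigr do rewrite scalerA.
  rewrite -scaler_suml -scalerDl mulrDr mulr_sumr; congr ((_ + _) *: _).
  by apply: eq_bigr => b _; rewrite mulrCA.
under eq_bigr do rewrite sp mulr_sumr.
rewrite exchange_big/= {1}(mpolyE q) !big_seq; apply: eq_bigr => m mq.
have mi : (m i <= d)%N by apply: leq_trans qd; exact: leq_bigmax_seq.
rewrite {1}(mpolyX_split R i m) -(poly_atX R) (H _ mi) /poly_at linear_sum/=.
rewrite mulr_suml scaler_sumr; apply: eq_bigr => a _.
rewrite -/(poly_at i _) poly_atZ -scalerAl scalerA -scalerAr.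
by congr (_ *: _).
Qed.

Lemma in_vars_deg_lin J r (I : Type) (s : seq I) (c : I -> R) (F : I -> {mpoly R[n]}) p :
  in_vars_deg J r p -> (forall i, in_vars_deg J r (F i)) ->
  in_vars_deg J r (p + \sum_(i <- s) c i *: F i).
Proof.
move=> [h1 h2] h; split; last apply/mdeg_leE; apply: supp_inD => //;
  try exact/mdeg_leE; apply: supp_in_sum => i _; apply: supp_inZ.
- exact: (h i).1.
- exact/mdeg_leE/(h i).2.
Qed.

(** Slicing in one variable lowers the minimum [eta] by at most delta B and multiplies the bound [B]
    by at most 1 + delta. The last hypothesis is stable under this change and reads 0 <= eta when no
    variable is left. *)
Lemma kernel_preordering (d : nat) (r : 'I_n -> nat) (delta : R) (k : nat) J q (B eta : R) :
  0 <= delta -> #|J| = k ->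
  (forall i, i \in J -> [/\ (0 < r i)%N, (d%:R * pi) ^+ 2 <= (r i)%:R ^+ 2 :> R
     & 2 * d%:R ^+ 3 * pi ^+ 2 / (r i)%:R ^+ 2 <= delta]) ->
  in_vars_deg J (fun=> d) q ->
  (forall x, box x -> eta <= peval q x /\ `|peval q x| <= B) ->
  B * ((1 + delta) ^+ k - 1) <= eta ->
  preordering r J q.
Proof.
move=> d0; elim: k J q B eta => [|k IH] J q B eta Jk hr [Jq dq] hq hB.
  have J0 : J = @finset.set0 'I_n by apply/eqP; rewrite -cards_eq0 Jk.
  move: Jq; rewrite J0 => /in_vars_set0 qE; rewrite qE; apply: preordering_const.
  have := (hq _ (@box0 R n)).1; rewrite {1}qE /peval mevalC; apply: le_trans.
  by move: hB; rewrite expr0 subrr mulr0.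
have [i iJ] : exists i, i \in J by apply/set0Pn; rewrite -cards_eq0 Jk.
have [ri0 rd rdelta] := hr i iJ.
have [Q [y [E [A1 [B1 [C1 [D1 [h [hh yb sz Eb H]]]]]]]]] := jackson_kernel _ _ _ ri0 rd.
rewrite (specialize_quadrature H (dq i)).
have B0 : 0 <= B by apply: le_trans (hq _ (@box0 R n)).2; exact: normr_ge0.
have Ji : #|J :\ i| = k by move: Jk; rewrite (cardsD1 i) iJ => -[].
have sums (I : finType) (F : I -> {mpoly R[n]}) :
    (forall a, preordering r J (F a)) -> preordering r J (\sum_a F a).
  move=> hF; elim/big_ind: _ => //; first exact: preordering0.
  exact: preorderingD.
apply: sums => a; have [s1 s2 s3 s4] := sz a.
apply: (preordering_mul_poly_at iJ hh) => //.
have sv c : in_vars_deg (J :\ i) (fun=> d) (specialize [set~ i] c q).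
  by rewrite finset.setDE; exact: specialize_vars.
apply: (IH _ _ ((1 + delta) * B) (eta - delta * B)) => //.
- by move=> j; rewrite inE => /andP[_]; exact: hr.
- exact: in_vars_deg_lin.
- move=> x bx; pose v a := peval q (mix [set~ i] x (fun=> y a)).
  have vb b : eta <= v b /\ `|v b| <= B.
    by apply: hq; apply: box_mix => //; exact: box_cst.
  have -> : peval (specialize [set~ i] (fun=> y a) q
      + \sum_b E a b *: specialize [set~ i] (fun=> y b) q) x
     = v a + \sum_b E a b * v b.
    rewrite pevalD peval_specialize peval_sum; congr (_ + _).
    by apply: eq_bigr => b _; rewrite pevalZ peval_specialize.
  have eb : `|\sum_b E a b * v b| <= delta * B.
    apply: le_trans (ler_norm_sum _ _ _) _.
    apply: (@le_trans _ _ (\sum_b `|E a b| * B)).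
      by apply: ler_sum => b _; rewrite normrM ler_wpM2l// (vb b).2.
    rewrite -mulr_suml ler_wpM2r//; exact: le_trans (Eb a) rdelta.
  have [v1 v2] := vb a; split.
    by move: eb; rewrite ler_norml => /andP[]; lra.
  by apply: le_trans (ler_normD _ _) _; lra.
- move: hB; rewrite exprS; move: ((1 + delta) ^+ k) => z; lra.
Qed.

End KernelPreordering.

(** * Decomposition along the cliques *)

Section LipschitzFunctions.
Variables (R : realType) (n : nat).
Implicit Types (f g : ('I_n -> R) -> R) (x y : 'I_n -> R) (J : {set 'I_n}).

(** A Lipschitz constant for this distance bounds every [Lipvar], which suits Jackson's estimate,
    and a Euclidean constant is also one for it. *)
Definition l1dist x y : R := \sum_i `|x i - y i|.

Definition lip1 (a : R) f := forall x y, box x -> box y -> `|f x - f y| <= a * l1dist x y.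

Definition depends_on J f := forall x y, (forall i, i \in J -> x i = y i) -> f x = f y.

Lemma l1dist_ge0 x y : 0 <= l1dist x y.
Proof. by apply: sumr_ge0. Qed.

Lemma l1dist_box x y : box x -> box y -> l1dist x y <= 2 * n%:R.
Proof.
move=> bx b_y; apply: (@le_trans _ _ (\sum_(i < n) 2)).
  apply: ler_sum => i _; have /andP[? ?] := bx i; have /andP[? ?] := b_y i.
  by rewrite ler_norml; lra.
by rewrite sumr_const card_ord mulr_natr.
Qed.

Lemma l1dist_mix J x y z : l1dist (mix J x z) (mix J y z) <= l1dist x y.
Proof.
apply: ler_sum => i _; rewrite /mix; case: ifP => // _.
by rewrite subrr normr0.
Qed.

Lemma coord_le_edist x y i : `|x i - y i| <= edist x y.
Proof.
rewrite -sqrtr_sqr; apply: ler_wsqrtr.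
by rewrite (bigD1 i)//= lerDl; apply: sumr_ge0 => j _; exact: sqr_ge0.
Qed.

Lemma l1dist_le_edist x y : l1dist x y <= n%:R * edist x y.
Proof.
apply: (@le_trans _ _ (\sum_(i < n) edist x y)).
  by apply: ler_sum => i _; exact: coord_le_edist.
by rewrite sumr_const card_ord mulr_natl.
Qed.

Lemma edist_le_l1dist x y : edist x y <= l1dist x y.
Proof.
rewrite -[leRHS](ger0_norm (l1dist_ge0 x y)) -sqrtr_sqr; apply: ler_wsqrtr.
rewrite expr2 {1}/l1dist mulr_suml; apply: ler_sum => i _.
rewrite -real_normK ?num_real// expr2 ler_wpM2l//.
by rewrite /l1dist (bigD1 i)//= lerDl; apply: sumr_ge0.
Qed.

Lemma edist_gt0 x y : x <> y -> 0 < edist x y.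
Proof.
move=> xy; rewrite lt0r sqrtr_ge0 andbT; apply/negP => /eqP e0; apply: xy.
apply/funext => i; apply/eqP; rewrite -subr_eq0 -normr_le0.
by rewrite -e0 coord_le_edist.
Qed.

Lemma lip1D a b f g : lip1 a f -> lip1 b g -> lip1 (a + b) (fun x => f x + g x).
Proof.
move=> hf hg x y bx b_y; rewrite opprD addrACA (le_trans (ler_normD _ _))//.
by rewrite mulrDl lerD ?hf ?hg.
Qed.

Lemma lip1B_cst a c f : lip1 a f -> lip1 a (fun x => f x - c).
Proof. by move=> hf x y bx b_y; rewrite opprB addrA subrK; exact: hf. Qed.

(** The bound gives stability under products, hence the property for all polynomials; their suprema
    in [Lip] and [supnorm] are then taken over bounded sets. *)
Definition bounded_lip1 f := exists a b : R,
  [/\ 0 <= a, 0 <= b, lip1 a f & forall x, box x -> `|f x| <= b].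

Lemma bounded_lip1_cst (c : R) : bounded_lip1 (fun=> c).
Proof.
exists 0, `|c|; split=> // x y _ _; by rewrite subrr normr0 mul0r.
Qed.

Lemma bounded_lip1_coord i : bounded_lip1 (fun x => x i).
Proof.
exists 1, 1; split=> // [x y _ _|x bx]; last by rewrite ler_norml; exact: bx.
by rewrite mul1r /l1dist (bigD1 i)//= lerDl; apply: sumr_ge0.
Qed.

Lemma bounded_lip1D f g : bounded_lip1 f -> bounded_lip1 g ->
  bounded_lip1 (fun x => f x + g x).
Proof.
move=> [a [b [a0 b0 h1 h2]]] [c [d [c0 d0 h3 h4]]].
exists (a + c), (b + d); split; rewrite ?addr_ge0//; first exact: lip1D.
by move=> x bx; rewrite (le_trans (ler_normD _ _))// lerD ?h2 ?h4.
Qed.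

Lemma bounded_lip1M f g : bounded_lip1 f -> bounded_lip1 g ->
  bounded_lip1 (fun x => f x * g x).
Proof.
move=> [a [b [a0 b0 h1 h2]]] [c [d [c0 d0 h3 h4]]].
exists (a * d + b * c), (b * d); split; rewrite ?addr_ge0 ?mulr_ge0//.
  move=> x y bx b_y.
  have -> : f x * g x - f y * g y = (f x - f y) * g x + f y * (g x - g y) by ring.
  rewrite (le_trans (ler_normD _ _))// !normrM mulrDl; apply: lerD.
    by rewrite mulrAC ler_pM// ?h1 ?h4.
  by rewrite -mulrA ler_pM// ?h2 ?h3.
by move=> x bx; rewrite normrM ler_pM// ?h2 ?h4.
Qed.

Lemma bounded_lip1_peval (p : {mpoly R[n]}) : bounded_lip1 (peval p).
Proof.
suff : bounded_lip1 (fun x => \sum_(m <- msupp p) mcoeff m p * \prod_i x i ^+ m i).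
  by congr bounded_lip1; apply/funext => x; rewrite /peval mevalE.
elim: (msupp p) => [|m s IH].
  by under eq_fun do rewrite big_nil; exact: bounded_lip1_cst.
under eq_fun do rewrite big_cons; apply: bounded_lip1D => //.
apply: bounded_lip1M; first exact: bounded_lip1_cst.
elim: (index_enum _) => [|i s' IH'].
  by under eq_fun do rewrite big_nil; exact: bounded_lip1_cst.
under eq_fun do rewrite big_cons; apply: bounded_lip1M => //.
elim: (m i) => [|k IHk]; first exact: bounded_lip1_cst.
by under eq_fun do rewrite exprS; apply: bounded_lip1M => //; exact: bounded_lip1_coord.
Qed.

Lemma le_supnorm f x : (exists b, forall x, box x -> `|f x| <= b) -> box x ->
  `|f x| <= supnorm f.
Proof.
move=> [b hb] bx; apply: ub_le_sup; last by exists x.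
by exists b => _ [y b_y <-]; exact: hb.
Qed.

Lemma lip1_Lip (p : {mpoly R[n]}) : lip1 (Lip (peval p)) (peval p).
Proof.
move=> x y bx b_y.
have [->|/eqP xy] := eqVneq (x : 'I_n -> R) y.
  rewrite subrr normr0 mulr_ge0 ?l1dist_ge0// /Lip le_max ler01//.
have e0 := edist_gt0 xy.
apply: (@le_trans _ _ (Lip (peval p) * edist x y)); last first.
  by rewrite ler_wpM2l ?edist_le_l1dist// /Lip le_max ler01.
rewrite -ler_pdivrMr// /Lip le_max; apply/orP; right.
apply: ub_le_sup; last by exists x, y.
have [a [b [a0 _ h _]]] := bounded_lip1_peval p.
exists (a * n%:R) => _ [u [v [bu bv uv ->]]].
rewrite ler_pdivrMr ?edist_gt0// -mulrA (le_trans (h u v bu bv))//.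
by rewrite ler_wpM2l// l1dist_le_edist.
Qed.

Lemma Lip_ge1 f : 1 <= Lip f.
Proof. by rewrite /Lip le_max lexx. Qed.

Definition min_out J f x : R := inf [set f (mix J x y) | y in @box R n].

Lemma min_out_depends J f : depends_on J (min_out J f).
Proof.
move=> x y xy; rewrite /min_out; congr inf; apply: eq_imagel => z _.
by congr f; apply/funext => i; rewrite /mix; case: ifP => // /xy.
Qed.

Section MinOut.
Variables (J : {set 'I_n}) (f : ('I_n -> R) -> R) (a : R).
Hypotheses (a0 : 0 <= a) (hf : lip1 a f).

Lemma min_out_le x y : box x -> box y -> min_out J f x <= f (mix J x y).
Proof.
move=> bx b_y; apply: ge_inf; last by exists y.
(* The box has l1 diameter at most 2 n, so the values are bounded below and [inf] is not a default
   value. *)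
exists (f x - a * (2 * n%:R)) => _ [z bz <-].
have bm : box (mix J x z) by exact: box_mix.
have := hf bx bm; rewrite ler_norml => /andP[_].
have := ler_wpM2l a0 (l1dist_box bx bm); lra.
Qed.

Lemma le_min_out x c : (forall y, box y -> c <= f (mix J x y)) -> c <= min_out J f x.
Proof.
move=> h; apply: lb_le_inf; first by exists (f (mix J x (fun=> 0))), (fun=> 0) => //; exact: box0.
by move=> _ [y b_y <-]; exact: h.
Qed.

(** An infimum of functions sharing a Lipschitz constant keeps it. *)
Lemma lip1_min_out : lip1 a (min_out J f).
Proof.
have H x y : box x -> box y -> min_out J f x - a * l1dist x y <= min_out J f y.
  move=> bx b_y; apply: le_min_out => z bz.
  have := min_out_le bx bz.
  have := hf (box_mix J bx bz) (box_mix J b_y bz); rewrite ler_norml => /andP[_].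
  have := ler_wpM2l a0 (l1dist_mix J x y z); lra.
move=> x y bx b_y; rewrite ler_norml.
have := H x y bx b_y; have := H y x b_y bx.
have -> : l1dist y x = l1dist x y by apply: eq_bigr => i _; rewrite distrC.
move=> ? ?; apply/andP; split; lra.
Qed.

End MinOut.

(** Jackson's polynomial may involve all the variables; setting those outside [J] to 0 does not
    affect g and preserves the error. Only the variables of [J] contribute to the sum of the
    [Lipvar], whence the factor [#|J|]. *)
Lemma jackson_lip1 (C : R) (hC : jackson_constant C) (hn : (0 < n)%N) (m : nat)
    (m0 : (0 < m)%N) J g (a : R) :
  0 <= a -> lip1 a g -> depends_on J g ->
  exists2 q : {mpoly R[n]}, in_vars_deg J (fun=> m) q &
    forall x, box x -> `|g x - peval q x| <= C * (#|J|%:R * a / m%:R).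
Proof.
move=> a0 hg hJ; have [C0 HC] := hC.
have lb : lipschitz_box g.
  exists (a * n%:R) => x y bx b_y; rewrite (le_trans (hg x y bx b_y))// -mulrA.
  by rewrite ler_wpM2l// l1dist_le_edist.
have [q [qm qe _]] := HC n hn g lb (fun=> m) (fun=> m0).
have Lv i : Lipvar g i <= if i \in J then a else 0.
  apply: ge_inf; first by exists 0 => c [].
  split=> [|x y bx b_y xy]; first by case: ifP.
  case: ifP => iJ; last first.
    rewrite mul0r (hJ x y) ?subrr ?normr0// => k kJ; apply: xy.
    by apply: contraTneq kJ => ->; rewrite iJ.
  apply: le_trans (hg x y bx b_y) _; rewrite ler_wpM2l// /l1dist (bigD1 i)//= big1 ?addr0//.
  by move=> k ki; rewrite xy// subrr normr0.
have bnd : exists b, forall x, box x -> `|g x - peval q x| <= b.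
  have [a1 [b1 [_ _ _ hb]]] := bounded_lip1_peval q.
  exists (`|g (fun=> 0)| + a * (2 * n%:R) + b1) => x bx.
  rewrite (le_trans (ler_normB _ _))// lerD ?hb//.
  have -> : g x = g (fun=> 0) + (g x - g (fun=> 0)) by ring.
  rewrite (le_trans (ler_normD _ _))// lerD// (le_trans (hg _ _ bx (@box0 R n)))//.
  by rewrite ler_wpM2l// l1dist_box//; exact: box0.
exists (specialize J (fun=> 0) q).
  have := @specialize_vars R n J [set: 'I_n]%SET (fun=> m) (fun=> 0) q.
  rewrite finset.setTI; apply; split=> //.
  by move=> ? _ i; rewrite inE.
move=> x bx; rewrite peval_specialize.
have -> : g x = g (mix J x (fun=> 0)) by apply: hJ => i iJ; rewrite /mix iJ.
apply: le_trans (le_supnorm bnd (box_mix J bx (@box0 R n))) _.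
apply: le_trans qe _; apply: ler_wpM2l; first exact: ltW.
apply: (@le_trans _ _ (\sum_(i < n) (if i \in J then a else 0) / m%:R)).
  by apply: ler_sum => i _; rewrite ler_wpM2r ?invr_ge0.
by rewrite -mulr_suml -big_mkcond/= sumr_const mulr_natl.
Qed.

End LipschitzFunctions.

(** * Redistribution of positivity under running intersection *)

Section SparseDecomposition.
Variables (R : realType) (n : nat) (CJac : R).
Hypotheses (hC : jackson_constant CJac) (hn : (0 < n)%N).
Variables (m Jb : nat) (L e eta : R).
Hypotheses (m_gt0 : (0 < m)%N) (he : CJac * (Jb%:R * L / m%:R) <= e).

Lemma in_vars_degW (J K : {set 'I_n}) r (q : {mpoly R[n]}) :
  J \subset K -> in_vars_deg J r q -> in_vars_deg K r q.
Proof. by move=> JK [h1 h2]; split=> //; exact: in_varsW h1. Qed.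

Lemma in_vars_degD (J : {set 'I_n}) r (p q : {mpoly R[n]}) :
  in_vars_deg J r p -> in_vars_deg J r q -> in_vars_deg J r (p + q).
Proof.
move=> [h1 h2] [h3 h4]; split; first exact: (@supp_inD _ _ (vars_in J)).
by apply/mdeg_leE; apply: supp_inD; apply/mdeg_leE.
Qed.

Lemma in_vars_degN (J : {set 'I_n}) r (p : {mpoly R[n]}) :
  in_vars_deg J r p -> in_vars_deg J r (- p).
Proof.
move=> [h1 h2]; split; first exact: (@supp_inN _ _ (vars_in J)).
by apply/mdeg_leE; apply: supp_inN; apply/mdeg_leE.
Qed.

Lemma in_vars_degC (J : {set 'I_n}) r (c : R) : in_vars_deg J r (mpolyC n c).
Proof.
split; first by apply: (@supp_inC _ _ (vars_in J)) => i _; rewrite mnm0E.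
by apply/mdeg_leE; apply: (@supp_inC _ _ (degs_le r)) => i; rewrite mnm0E.
Qed.

(** Each removal of the last clique costs 2 e + eta. Its Lipschitz constant is added to that of
    clique s, which keeps the sum of the [a j] fixed: every transferred function has constant at
    most [L], and one degree [m] serves throughout. *)
Lemma sparse_decomposition (l : nat) (J : nat -> {set 'I_n})
    (f : nat -> ('I_n -> R) -> R) (a : nat -> R) :
  (forall k, (0 < k <= l)%N -> exists2 s, (s < k)%N &
     forall i j, i \in J k -> (j < k)%N -> i \in J j -> i \in J s) ->
  (forall j, (j <= l)%N -> [/\ (#|J j| <= Jb)%N, depends_on (J j) (f j),
     0 <= a j & lip1 (a j) (f j)]) ->
  \sum_(j < l.+1) a j <= L ->
  (forall x, box x -> l%:R * (2 * e + eta) + eta <= \sum_(j < l.+1) f j x) ->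
  exists Q : nat -> {mpoly R[n]},
    [/\ forall j, (j <= l)%N -> in_vars_deg (J j) (fun=> m) (Q j),
        \sum_(j < l.+1) Q j = 0
      & forall j x, (j <= l)%N -> box x -> eta <= f j x + peval (Q j) x].
Proof.
elim: l f a => [|l IH] f a hJ hf ha hsum.
  exists (fun=> 0); split=> [j _||j x j0 bx].
  - by rewrite -mpolyC0; exact: in_vars_degC.
  - by rewrite big1.
  - move: (hsum x bx); rewrite big_ord_recl big_ord0 mul0r add0r addr0.
    move: j0; rewrite leqn0 => /eqP ->.
    by rewrite -mpolyC0 pevalC addr0.
have [s sl hs] := hJ l.+1 (leqnn _).
have [Jl dl al0 cl] := hf l.+1 (leqnn _).
(* Running intersection places all that the last clique shares with the earlier ones in the single
   clique [s]. *)
pose I := J l.+1 :&: [set i | [exists j : 'I_l.+1, i \in J j]]%SET.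
have IJl : I \subset J l.+1 by exact: finset.subsetIl.
have IJs : I \subset J s.
  apply/fintype.subsetP => i; rewrite !inE => /andP[iJ /existsP[j ij]].
  exact: (hs i j).
pose g := min_out I (f l.+1).
have gI : depends_on I g := @min_out_depends _ _ _ _.
have cg : lip1 (a l.+1) g := lip1_min_out I al0 cl.
have [q qI qg] := jackson_lip1 hC hn m_gt0 al0 cg gI.
have [C0 _] := hC.
have a_ge0 (j : 'I_l.+2) : 0 <= a j by have [] := hf j (leq_ord j).
have qe x : box x -> `|g x - peval q x| <= e.
  move=> bx; apply: le_trans (qg x bx) (le_trans _ he); apply: ler_wpM2l; first exact: ltW.
  apply: ler_wpM2r; first by rewrite invr_ge0.
  apply: ler_pM => //; first by rewrite ler_nat (leq_trans (subset_leq_card IJl)).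
  apply: le_trans ha; rewrite big_ord_recr /= lerDr; apply: sumr_ge0 => j _.
  exact: (a_ge0 (widen_ord (leqnSn _) j)).
(* The shift by [2 e + eta] makes up for the error of [q] in both summands. *)
pose f' j := if j == s then fun x => (f j x + g x) - (2 * e + eta) else f j.
pose a' j := if j == s then a j + a l.+1 else a j.
have sum_at (V : zmodType) (F : nat -> V) (c : V) :
    \sum_(j < l.+1) (if j == s :> nat then F j + c else F j) = \sum_(j < l.+1) F j + c.
  rewrite (bigD1 (Ordinal sl))//= eqxx [in RHS](bigD1 (Ordinal sl))//= addrAC.
  congr (_ + _ + _); apply: eq_bigr => j js; case: eqP => // /eqP js'.
  by case/negP: js; apply/eqP/val_inj/eqP.
have [||||Q [Qd Q0 Qp]] := IH f' a'.
- by move=> k /andP[k0 kl]; apply: hJ; rewrite k0 ltnW.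
- move=> j jl; have [h1 h2 h3 h4] := hf j (leqW jl).
  rewrite /f' /a'; case: eqP => [js|_]; split=> //.
  + move=> x y xy; rewrite (h2 x y xy) (gI x y)// => i iI; apply: xy.
    by rewrite js; exact: (fintype.subsetP IJs).
  + exact: addr_ge0.
  + by apply: lip1B_cst; exact: lip1D.
- by rewrite /a' sum_at; move: ha; rewrite big_ord_recr.
- move=> x bx; rewrite /f'.
  have -> : \sum_(j < l.+1) (if j == s :> nat then fun x0 => f j x0 + g x0 - (2 * e + eta)
      else f j) x = \sum_(j < l.+1) f j x + (g x - (2 * e + eta)).
    rewrite -(sum_at _ (fun j => f j x)); apply: eq_bigr => j _; case: eqP => // _.
    by rewrite addrA.
  suff : (l.+1)%:R * (2 * e + eta) + eta - \sum_(j < l.+1) f j x <= g x.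
    by rewrite -natr1 mulrDl mul1r; lra.
  apply: le_min_out => y b_y.
  (* With [U] the union of the earlier cliques, replacing x by y outside [U] leaves the earlier
     summands unchanged and amounts, in the last one, to replacing x by y outside [I]. *)
  pose U := [set i | [exists j : 'I_l.+1, i \in J j]]%SET.
  have := hsum (mix U x y) (box_mix U bx b_y); rewrite big_ord_recr /=.
  have -> : f l.+1 (mix U x y) = f l.+1 (mix I x y).
    by apply: dl => i iJ; rewrite /mix /I finset.in_setI iJ.
  have -> : \sum_(j < l.+1) f j (mix U x y) = \sum_(j < l.+1) f j x.
    apply: eq_bigr => j _; have [_ h2 _ _] := hf j (leqW (leq_ord j)).
    apply: h2 => i iJ; rewrite /mix inE; case: ifP => // /existsP[].
    by exists j.
  lra.
(* As the last summand dominates g, subtracting q and adding [c] leaves at least eta. Clique [s]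
   loses [c] and at most another e from q, exactly the shift in [f']. *)
pose c := e + eta.
exists (fun j => if j == l.+1 then - q + mpolyC n c else
                 if j == s then Q j + (q - mpolyC n c) else Q j); split.
- move=> j jl; case: eqP => [->|/eqP jl'].
    apply: in_vars_degD; last exact: in_vars_degC.
    by apply: in_vars_degN; exact: in_vars_degW IJl qI.
  have jl2 : (j <= l)%N by rewrite -ltnS ltn_neqAle jl'.
  case: eqP => [js|_]; last exact: Qd.
  apply: in_vars_degD; first exact: Qd.
  apply: in_vars_degD; last by apply: in_vars_degN; exact: in_vars_degC.
  by rewrite js; exact: in_vars_degW IJs qI.
- rewrite big_ord_recr /= eqxx.
  rewrite (eq_bigr (fun j : 'I_l.+1 => if j == s :> nat then Q j + (q - mpolyC n c) else Q j)).
    by rewrite sum_at Q0 add0r addrACA subrr addNr addr0.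
  by move=> j _; rewrite ltn_eqF.
- move=> j x jl bx; have := qe x bx; rewrite ler_norml => /andP[q1 q2].
  case: eqP => [->|/eqP jl'].
    rewrite pevalD pevalN pevalC /c.
    have gf : g x <= f l.+1 x.
      have := min_out_le I al0 cl bx bx.
      by rewrite (_ : mix I x x = x)//; apply/funext => i; rewrite /mix; case: ifP.
    lra.
  have jl2 : (j <= l)%N by rewrite -ltnS ltn_neqAle jl'.
  have := Qp j x jl2 bx; rewrite /f'; case: eqP => // js.
  rewrite pevalD pevalD pevalN pevalC /c; lra.
Qed.

End SparseDecomposition.

(** * Main theorem *)

(** As long as 2 k x <= 1, one more factor 1 + x adds at most 2 x. *)
Lemma exprD1_le (R : realType) (x : R) (N k : nat) :
  0 <= x -> N%:R * x <= 1 / 2 -> (k <= N)%N -> (1 + x) ^+ k <= 1 + 2 * k%:R * x.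
Proof.
move=> x0 Nx; elim: k => [|k IH] kN; first by rewrite expr0 mulr0 mul0r addr0.
have kx : k%:R * x <= 1 / 2.
  by apply: le_trans Nx; rewrite ler_wpM2r// ler_nat ltnW.
rewrite exprSr; apply: le_trans (ler_wpM2r _ (IH (ltnW kN))) _; first lra.
rewrite -natr1; have := ler_wpM2r x0 kx; lra.
Qed.

Lemma clique_preordering (R : realType) (n : nat) (J : {set 'I_n}) (r : 'I_n -> nat)
    (q : {mpoly R[n]}) (D Jb : nat) (X B eps t : R) :
  (0 < n)%N -> (#|J| <= Jb)%N -> 1 <= t -> 0 < eps -> eps <= B -> 1 <= X -> D%:R <= X ->
  (forall i, (0 < r i)%N) ->
  (forall i, 2 ^+ (Jb + 3) * t * n%:R * pi ^+ 2 * B / eps * X ^+ (Jb + 2) <= (r i)%:R ^+ 2) ->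
  in_vars_deg J (fun=> D) q ->
  (forall x, box x -> eps / (4 * t) <= peval q x /\ `|peval q x| <= B) ->
  preordering r J q.
Proof.
move=> n0 JJb t1 e0 eB X1 DX r0 hr Jq hq.
have n1 : 1 <= n%:R :> R by rewrite ler1n.
have B0 : 0 < B by lra.
(* Chosen so that 2 n delta B = eps / (4 t), the lower bound of q. *)
pose delta := eps / (8 * t * n%:R * B).
have den : 0 < 8 * t * n%:R * B by rewrite !mulr_gt0//; lra.
have d0 : 0 <= delta by rewrite divr_ge0// ltW.
have nd : n%:R * delta <= 1 / 2.
  rewrite /delta mulrA ler_pdivrMr// -subr_ge0.
  have -> : 1 / 2 * (8 * t * n%:R * B) - n%:R * eps = n%:R * (4 * t * B - eps) by field.
  by rewrite mulr_ge0//; nra.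
apply: (kernel_preordering d0 erefl _ Jq hq); last first.
  have Jn : (#|J| <= n)%N by rewrite -[leqRHS]card_ord max_card.
  have := exprD1_le d0 nd Jn; rewrite -lerBlDl => h.
  apply: le_trans (ler_wpM2l (ltW B0) h) _.
  apply: (@le_trans _ _ (B * (2 * n%:R * delta))).
    by rewrite ler_pM2l// ler_wpM2r// ler_pM2l// ler_nat.
  rewrite le_eqVlt; apply/orP; left; apply/eqP; rewrite /delta; field.
  by rewrite !gt_eqF//; lra.
move=> i iJ.
(* A clique with a variable has Jb >= 1, so 2^(Jb + 3) is at least 16 and X^(Jb + 2) at least
   X^3. *)
have Jb1 : (1 <= Jb)%N.
  by apply: leq_trans JJb; rewrite card_gt0; apply/set0Pn; exists i.
have D0 : 0 <= D%:R :> R by [].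
have p0 := @pi_gt0 R.
have BE : 1 <= B / eps by rewrite ler_pdivlMr// mul1r.
pose s := t * n%:R * (B / eps).
have s1 : 1 <= s by rewrite /s -[leLHS]mulr1 ler_pM// -[leLHS]mulr1 ler_pM.
have key : 16 * s * pi ^+ 2 * X ^+ 3 <= (r i)%:R ^+ 2.
  apply: le_trans (hr i).
  have -> : 2 ^+ (Jb + 3) * t * n%:R * pi ^+ 2 * B / eps * X ^+ (Jb + 2)
          = 2 ^+ (Jb + 3) * (s * pi ^+ 2) * X ^+ (Jb + 2) by rewrite /s; ring.
  have sp : 0 <= s * pi ^+ 2 by rewrite mulr_ge0 ?sqr_ge0//; lra.
  have -> : 16 * s * pi ^+ 2 * X ^+ 3 = 2 ^+ 4 * (s * pi ^+ 2) * X ^+ 3 by ring.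
  have e2 : 2 ^+ 4 <= 2 ^+ (Jb + 3) :> R.
    by apply: ler_weXn2l; [rewrite (ler_nat _ 1)|exact: (leq_add Jb1 (leqnn 3))].
  have e3 : X ^+ 3 <= X ^+ (Jb + 2).
    by apply: ler_weXn2l => //; exact: (leq_add Jb1 (leqnn 2)).
  apply: ler_pM.
  - by rewrite mulr_ge0// exprn_ge0.
  - by rewrite exprn_ge0//; lra.
  - exact: (ler_wpM2r sp e2).
  - exact: e3.
have DX3 : D%:R ^+ 3 <= X ^+ 3 by apply: lerXn2r; rewrite ?nnegrE//; lra.
split=> //.
  apply: le_trans key; rewrite exprMn.
  have -> : 16 * s * pi ^+ 2 * X ^+ 3 = 16 * s * X ^+ 3 * pi ^+ 2 by ring.
  apply: ler_wpM2r; first exact: sqr_ge0.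
  have D2 : D%:R ^+ 2 <= X ^+ 2 by apply: lerXn2r; rewrite ?nnegrE//; lra.
  apply: le_trans D2 _; rewrite [X ^+ 3]exprS; have := sqr_ge0 X.
  have : 1 <= 16 * s * X by nra.
  by rewrite mulrA => h h2; rewrite -[leLHS]mul1r; apply: ler_wpM2r.
rewrite ler_pdivrMr; last by rewrite exprn_gt0// ltr0n.
have r2 : 0 < (r i)%:R ^+ 2 :> R by rewrite exprn_gt0// ltr0n.
have -> : delta * (r i)%:R ^+ 2 = eps * (r i)%:R ^+ 2 / (8 * t * n%:R * B).
  by rewrite /delta; ring.
rewrite ler_pdivlMr//.
have -> : 2 * D%:R ^+ 3 * pi ^+ 2 * (8 * t * n%:R * B) =
  eps * (16 * s * pi ^+ 2 * D%:R ^+ 3) by rewrite /s; field; rewrite gt_eqF.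
rewrite ler_pM2l//; apply: le_trans key; apply: ler_wpM2l => //.
by rewrite mulr_ge0 ?sqr_ge0//; lra.
Qed.

(** Since eps <= l2, a factor l2 / eps can be pulled out of the base, the summand 2 included. Its
    power Jb + 2 and the prefactor l2 / eps give (l2 / eps)^(Jb + 3). *)
Lemma simple_bound_degree (R : realType) (C L eps normp l2 n0 M : R) (Jb : nat) :
  0 <= C -> 0 <= L -> 0 < eps -> 0 <= normp -> 0 < l2 -> 0 <= n0 -> eps <= l2 ->
  M <= 4 * C * l2 * (Jb%:R * L / eps) ->
  2 ^+ (Jb + 3) * l2 * n0 * pi ^+ 2 * normp / eps
      * (Num.max M (4 * C * l2 * (Jb%:R * L / eps)) + 2) ^+ (Jb + 2)
  <= n0 * pi ^+ 2 * (4 * C * Jb%:R * L + 2) ^+ (Jb + 2)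
      * (2 * l2) ^+ (Jb + 3) * normp / eps ^+ (Jb + 3).
Proof.
move=> C0 L0 e0 N0 l0 nn0 el hM; rewrite (max_idPr hM).
set Y := 4 * C * l2 * _; set Z := 4 * C * Jb%:R * L.
have Y0 : 0 <= Y by rewrite /Y !mulr_ge0// ?invr_ge0 ltW.
have Z0 : 0 <= Z by rewrite /Z !mulr_ge0.
have YZ : Y + 2 <= l2 / eps * (Z + 2).
  have -> : l2 / eps * (Z + 2) = Y + 2 * (l2 / eps).
    by rewrite /Y /Z; field; rewrite gt_eqF.
  by rewrite lerD2l -[leLHS]mulr1 ler_pM2l// ler_pdivlMr// mul1r.
have P0 : 0 <= 2 ^+ (Jb + 3) * l2 * n0 * pi ^+ 2 * normp / eps.
  by rewrite !mulr_ge0// ?exprn_ge0// ?pi_ge0// ?invr_ge0 ltW.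
apply: le_trans (ler_wpM2l P0 (_ : _ <= (l2 / eps * (Z + 2)) ^+ (Jb + 2))) _.
  apply: lerXn2r => //; rewrite nnegrE; first lra.
  by apply: le_trans YZ; lra.
rewrite le_eqVlt; apply/orP; left; apply/eqP.
rewrite !exprMn exprVn [(Jb + 3)%N]addnS !exprS; field.
by rewrite expf_neq0 gt_eqF.
Qed.

Lemma sqrt_bigO_powR (R : realType) (K : R) (k : nat) :
  0 <= K ->
  (fun e : R => Num.sqrt (K / e ^+ k)) =O_ (0^'+) (fun e : R => e `^ (- (k%:R / 2))).
Proof.
(* Adding 1 keeps the constant positive when K = 0. *)
move=> K0; apply/eqO_exP; exists (Num.sqrt K + 1); first by rewrite ltr_wpDl ?sqrtr_ge0.
near=> e.
have e0 : 0 < e by [].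
have E : Num.sqrt (K / e ^+ k) = Num.sqrt K * e `^ (- (k%:R / 2)).
  rewrite sqrtrM// sqrtrV ?exprn_ge0 ?ltW// powRN; congr (_ / _).
  by rewrite powRrM powR_mulrn ?ltW// powR12_sqrt// exprn_ge0// ltW.
rewrite E normrM ler_wpM2r// ger0_norm ?sqrtr_ge0//; lra.
Unshelve. all: by end_near. Qed.

Lemma sparse_representation (R : realType) (CJac : R) (n l : nat)
    (r : 'I_l.+1 -> 'I_n -> nat) (J : 'I_l.+1 -> {set 'I_n})
    (ps : 'I_l.+1 -> {mpoly R[n]}) (eps L X : R) (M Jb : nat) :
  jackson_constant CJac -> (0 < n)%N -> running_intersection J ->
  (forall j i, (0 < r j i)%N) ->
  (forall j, in_vars_deg (J j) (fun=> M) (ps j)) ->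
  (forall j, (#|J j| <= Jb)%N) -> \sum_j Lip (peval (ps j)) <= L ->
  0 < eps -> (forall x, box x -> eps <= peval (\sum_j ps j) x) ->
  1 <= X -> M%:R <= X -> 4 * CJac * (l.+1 + 2)%:R * (Jb%:R * L / eps) + 1 <= X ->
  (forall j i, 2 ^+ (Jb + 3) * (l.+1 + 2)%:R * n%:R * pi ^+ 2
     * supnorm (peval (\sum_j ps j)) / eps * X ^+ (Jb + 2) <= (r j i)%:R ^+ 2) ->
  sum_preordering r J (\sum_j ps j).
Proof.
move=> hC n0 hJ r0 hps JJb hL e0 hpos X1 MX YX hr.
have [C0 _] := hC.
set p := \sum_j ps j in hpos hr *.
set t : R := (l.+1 + 2)%:R in YX hr.
set Y := 4 * CJac * t * (Jb%:R * L / eps) in YX.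
have t1 : 1 <= t by rewrite ler1n.
have L0 : 0 <= L.
  by apply: le_trans hL; apply: sumr_ge0 => j _; exact: le_trans ler01 (Lip_ge1 _).
have Y0 : 0 <= Y by rewrite /Y !mulr_ge0// ?invr_ge0 ?ltW//; lra.
(* The degree of the Jackson approximations: m >= Y brings their error below [eta], and m <= Y + 1
   keeps m below X. *)
pose m := (Num.truncn Y).+1.
have Ym : Y <= m%:R by rewrite ltW// truncnS_gt.
have mY : m%:R <= Y + 1 by rewrite -natr1 lerD2r truncn_le.
have m0 : (0 : R) < m%:R by rewrite ltr0n.
pose eta := eps / (4 * t).
have eta0 : 0 < eta by rewrite divr_gt0//; lra.
have he : CJac * (Jb%:R * L / m%:R) <= eta.
  rewrite /eta mulrA ler_pdivrMr// mulrAC ler_pdivlMr; last lra.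
  have -> : CJac * (Jb%:R * L) * (4 * t) = eps * Y by rewrite /Y; field; rewrite gt_eqF.
  by rewrite ler_pM2l.
pose Jn (j : nat) := J (inord j).
pose psn (j : nat) := ps (inord j).
have [|||||Q [Qd Q0 Qp]] := @sparse_decomposition R n CJac hC n0 m Jb L eta eta _ he l Jn
   (fun j => peval (psn j)) (fun j => Lip (peval (psn j))).
- by [].
- move=> k /andP[k0 kl]; have kE : (inord k : 'I_l.+1) = k :> nat by rewrite inordK.
  have [|s sk hs] := hJ (inord k); first by rewrite kE.
  exists s; first by rewrite kE in sk.
  move=> i j ik jk ij; rewrite /Jn inord_val; apply: (fintype.subsetP hs).
  rewrite finset.in_setI ik; apply/finset.bigcupP; exists (inord j) => //.
  rewrite kE inordK//; exact: leq_trans (ltnW jk) _.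
- move=> j jl; split; [exact: JJb| |exact: le_trans ler01 (Lip_ge1 _)|exact: lip1_Lip].
  move=> x y xy; rewrite /peval !mevalE !big_seq; apply: eq_bigr => u us.
  congr (_ * _); apply: eq_bigr => i _.
  have [iJ|iJ] := boolP (i \in Jn j); first by rewrite xy.
  by rewrite ((hps (inord j)).1 u us i iJ).
- by apply: le_trans hL; rewrite le_eqVlt; apply/orP; left; apply/eqP;
    apply: eq_bigr => j _; rewrite /psn inord_val.
- move=> x bx; have -> : \sum_(j < l.+1) peval (psn j) x = peval p x.
    by rewrite /p peval_sum; apply: eq_bigr => j _; rewrite /psn inord_val.
  apply: le_trans (hpos x bx).
  (* Error and margin are both [eta], so the l transfers cost 3 l eta in all; here t = l + 3, whence
     (3 l + 1) eta <= eps. *)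
  have -> : l%:R * (2 * eta + eta) + eta = eps * ((3 * l%:R + 1) / (4 * t)).
    by rewrite /eta; field; rewrite gt_eqF//; lra.
  rewrite -[leRHS]mulr1 ler_pM2l// ler_pdivrMr; last lra.
  have l0 : 0 <= l%:R :> R by [].
  by rewrite /t natrD -natr1; lra.
pose q (j : 'I_l.+1) := ps j + Q j.
have qp : p = \sum_j q j by rewrite /q big_split /= Q0 addr0.
have qeta j x : box x -> eta <= peval (q j) x.
  move=> bx; have := Qp j x (leq_ord j) bx.
  by rewrite /q pevalD /psn inord_val.
have bp x : box x -> `|peval p x| <= supnorm (peval p).
  move=> bx; apply: le_supnorm => //.
  by have [a [b [_ _ _ hb]]] := bounded_lip1_peval p; exists b.
exists q; split=> // j.
apply: (@clique_preordering R n (J j) (r j) (q j) (maxn M m) Jb X (supnorm (peval p)) eps t) => //.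
- apply: le_trans (hpos _ (@box0 R n)) _; apply: le_trans (ler_norm _) _.
  exact: bp (@box0 R n).
- by rewrite natr_max ge_max MX (le_trans mY).
- apply: in_vars_degD.
    have [h1 h2] := hps j; split=> // i; exact: leq_trans (h2 i) (leq_maxl _ _).
  have [h1 h2] := Qd j (leq_ord j); split; first by rewrite /Jn inord_val in h1.
  by move=> i; exact: leq_trans (h2 i) (leq_maxr _ _).
- move=> x bx; split; first exact: qeta.
  have qj0 i : 0 <= peval (q i) x by apply: le_trans (qeta i x bx); exact: ltW.
  rewrite ger0_norm//; apply: le_trans (bp x bx); apply: le_trans (ler_norm _).
  by rewrite qp peval_sum (bigD1 j)//= lerDl; apply: sumr_ge0.
Qed.

Theorem theorem2 (R : realType) (CJac : R) (hC : jackson_constant CJac)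
    (n l : nat) (hn : (0 < n)%N) (hl : (2 <= l)%N)
    (r : 'I_l -> 'I_n -> nat) (hr : forall j i, (0 < r j i)%N)
    (J : 'I_l -> {set 'I_n}) (hJ : running_intersection J)
    (ps : 'I_l -> {mpoly R[n]})
    (hps : forall j, in_vars_deg (J j) (r j) (ps j))
    (p : {mpoly R[n]}) (hp : p = \sum_(j < l) ps j)
    (eps : R) (heps : 0 < eps)
    (hpos : forall x : 'I_n -> R, box x -> eps <= peval p x) :
  let L : R := \sum_(k < l) Lip (peval (ps k)) in
  let M : nat := (\max_(k < l) \max_(m < n) degvar (ps k) m)%N in
  let Jb : nat := (\max_(k < l) #|J k|)%N in
  let normp : R := supnorm (peval p) in
  let A : R :=
    n%:R * pi ^+ 2 * (4 * CJac * Jb%:R * L + 2) ^+ (Jb + 2)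
      * (2 * (l + 2)%:R) ^+ (Jb + 3) in
  let degree_condition : Prop := forall (j : 'I_l) (i : 'I_n),
    2 ^+ (Jb + 3) * (l + 2)%:R * n%:R * pi ^+ 2 * normp / eps
      * (Num.max M%:R (4 * CJac * (l + 2)%:R * (Jb%:R * L / eps)) + 2)
          ^+ (Jb + 2)
    <= (r j i)%:R ^+ 2 in
  let simple_bound (e : R) : R := Num.sqrt (A * normp / e ^+ (Jb + 3)) in
  [/\ degree_condition -> sum_preordering r J p,
      (* small eps; the quotient bound is +oo when M = 0 *)
      ((0 < M)%N -> eps < 4 * CJac * (l + 2)%:R * Jb%:R * L / M%:R) ->
      eps <= (l + 2)%:R ->
      (forall j i, simple_bound eps <= (r j i)%:R) ->
      degree_condition /\ sum_preordering r J p
    & simple_bound =O_ (0^'+) (fun e : R => e `^ (- ((Jb + 3)%:R / 2)))].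
Proof.
move=> L M Jb normp A degree_condition simple_bound.
have [C0 _] := hC.
have L0 : 0 <= L by apply: sumr_ge0 => j _; exact: le_trans ler01 (Lip_ge1 _).
have N0 : 0 <= normp.
  have [a [b [_ _ _ hb]]] := bounded_lip1_peval p.
  apply: le_trans (normr_ge0 (peval p (fun=> 0))) _; apply: le_supnorm (@box0 R n).
  by exists b.
have A0 : 0 <= A.
  have z0 : 0 <= 4 * CJac * Jb%:R * L by rewrite !mulr_ge0// ltW.
  by rewrite /A mulr_ge0 ?exprn_ge0 ?mulr_ge0 ?exprn_ge0 ?pi_ge0//; lra.
have main : degree_condition -> sum_preordering r J p.
  have Y0 : 0 <= 4 * CJac * (l + 2)%:R * (Jb%:R * L / eps).
    by rewrite !mulr_ge0// ?invr_ge0 ltW.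
  move=> hdeg; case: l hl r hr J hJ ps hps hp @L @M @Jb @A @degree_condition
    @simple_bound L0 A0 hdeg Y0 => // l hl r hr J hJ ps hps hp L M Jb A
    degree_condition simple_bound L0 A0 hdeg Y0.
  (* X is the base of the power in the degree condition; it exceeds both [M] and the Jackson
     degree. *)
  rewrite hp; apply: (@sparse_representation R CJac n l r J ps eps L
    (Num.max M%:R (4 * CJac * (l.+1 + 2)%:R * (Jb%:R * L / eps)) + 2) M Jb) => //.
  - move=> j; have [h1 _] := hps j; split=> // i.
    apply: leq_trans (leq_bigmax j); exact: (leq_bigmax i).
  - by move=> j; exact: (leq_bigmax j).
  - by rewrite -hp.
  - have : M%:R <= Num.max M%:R (4 * CJac * (l.+1 + 2)%:R * (Jb%:R * L / eps)).
      by rewrite le_max lexx.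
    by have : (0 : R) <= M%:R by []; lra.
  - have : M%:R <= Num.max M%:R (4 * CJac * (l.+1 + 2)%:R * (Jb%:R * L / eps)).
      by rewrite le_max lexx.
    lra.
  - have : 4 * CJac * (l.+1 + 2)%:R * (Jb%:R * L / eps)
        <= Num.max M%:R (4 * CJac * (l.+1 + 2)%:R * (Jb%:R * L / eps)).
      by rewrite le_max lexx orbT.
    lra.
  - by rewrite -hp.
split=> // [hM heps2 hsimple|].
  suff hdeg : degree_condition by split=> //; exact: main.
  move=> j i.
  have MY : M%:R <= 4 * CJac * (l + 2)%:R * (Jb%:R * L / eps).
    (* For M = 0 the quotient bound on [eps] says nothing, and the inequality is the nonnegativity
       of its right-hand side. *)
    have [->|M0] := posnP M; first by rewrite !mulr_ge0// ?invr_ge0 ltW.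
    have M0' : (0 : R) < M%:R by rewrite ltr0n.
    have := hM M0; rewrite ltr_pdivlMr// => h.
    by rewrite !mulrA ler_pdivlMr// mulrC ltW.
  have l0 : (0 : R) < (l + 2)%:R by rewrite ltr0n addn2.
  apply: le_trans (simple_bound_degree (ltW C0) L0 heps N0 l0 (ler0n _ _) heps2 MY) _.
  have K0 : 0 <= A * normp / eps ^+ (Jb + 3).
    by apply: divr_ge0; [exact: mulr_ge0|exact: exprn_ge0 (ltW heps)].
  rewrite -/A -(sqr_sqrtr K0); apply: lerXn2r; rewrite ?nnegrE ?sqrtr_ge0//.
by apply: sqrt_bigO_powR; exact: mulr_ge0.
Qed.
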